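(* Let $R$ be a commutative ring, $S$ a module-finite $R$-algebra, $M$ a direct summand of a direct sum of finitely presented right $S$-modules, and $N$ a finitely generated right $S$-module. Suppose that $Y:=\operatorname{Max}(R)\cap\operatorname{Supp}_R(N)$ is Noetherian with $\dim(Y)<\infty$. Then the following statements hold: (1) Let $t$ be a positive integer, and suppose that $\operatorname{sur}_{S_{\mathfrak m}}(M_{\mathfrak m},N_{\mathfrak m})\geqslant t+\dim(Y)$ for every $\mathfrak m\in Y$. Then $\operatorname{sur}_S(M,N)\geqslant t$. (2) $\operatorname{sur}_S(M,N)=\infty$ if and only if $\operatorname{sur}_{S_{\mathfrak m}}(M_{\mathfrak m},N_{\mathfrak m})=\infty$ for every $\mathfrak m\in Y$. (3) Suppose that $\operatorname{sur}_{S_{\mathfrak n}}(M_{\mathfrak n},N_{\mathfrak n})<\infty$ for some $\mathfrak n\in Y$. Then \[\operatorname{sur}_S(M,N)\geqslant \min\{\operatorname{sur}_{S_{\mathfrak m}}(M_{\mathfrak m},N_{\mathfrak m}):\mathfrak m\in Y\}-\dim(Y).\]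
   Context: Every ring has a $1$ and every module is unital; $S$ need not be commutative. A module-finite $R$-algebra is an $R$-algebra that is finitely generated as an $R$-module; right $S$-modules are viewed as $R$-modules in the natural way, and for $\mathfrak p\in\operatorname{Spec}(R)$, $M_{\mathfrak p}$, $N_{\mathfrak p}$, $S_{\mathfrak p}$ denote localizations at $R-\mathfrak p$. For an algebra $S$ over a commutative ring and right $S$-modules $M,N$, $\operatorname{sur}_S(M,N)$ denotes the supremum (possibly $\infty$) of the nonnegative integers $t$ such that there exists a surjective $S$-linear map from $M$ to $N^{\oplus t}$. $\operatorname{Max}(R)$ is the set of maximal ideals of $R$ and $\operatorname{Supp}_R(N)=\{\mathfrak p\in\operatorname{Spec}(R):N_{\mathfrak p}\neq0\}$. Every subset $Y$ of $\operatorname{Spec}(R)$ carries the subspace topology induced by the Zariski topology; ''Noetherian'' means Noetherian as a topological space, and $\dim(Y)$ is the Krull dimension of $Y$ as a topological space, with $\dim(\varnothing)=-\infty$. *)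

(* Defs.v *)
From HB Require Import structures.
From mathcomp Require Import all_boot all_order all_algebra generic_quotient.
From mathcomp Require Import all_classical constructive_ereal topology.
From mathcomp Require Import ring.

Set Implicit Arguments.
Unset Strict Implicit.
Unset Printing Implicit Defensive.

Import Order.TTheory GRing.Theory Num.Theory.

Local Open Scope classical_set_scope.
Local Open Scope ring_scope.
Local Open Scope quotient_scope.

(* Rings are pzRingTypes, so that the zero ring is allowed. A right S-module
   is an lmodType over the converse ring S^c. *)

Section Modules.
Variable A : pzRingType.

Definition surjection (U V : Type) (f : U -> V) := forall y, exists x, f x = y.

Definition finitely_generated (N : lmodType A) : Prop :=
  exists (n : nat) (f : {linear 'rV[A]_n -> N}), surjection f.

Definition finitely_presented (N : lmodType A) : Prop :=
  exists (n k : nat) (f : {linear 'rV[A]_n -> N})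
         (g : {linear 'rV[A]_k -> 'rV[A]_n}),
    surjection f /\ range g = [set x | f x = 0].

Definition direct_summand (M D : lmodType A) : Prop :=
  exists (K : lmodType A) (f : {linear (M * K)%type -> D}), bijective f.

(* The values of t always include 0. A nonempty set of naturals without a
   greatest element has supremum +oo in \bar int. *)
Definition sur (M N : lmodType A) : \bar int :=
  supremum -oo%E [set t%:Z%:E%E | t in [set t : nat |
    exists f : {linear M -> {ffun 'I_t -> N}}, surjection f]].

End Modules.

Section DirectSum.
Variables (A : pzRingType) (I : Type) (P : I -> lmodType A).

Definition fin_supp (f : forall i, P i) := finite_set [set i | f i != 0].

Record dsum : Type := DSum {
  dsum_fun :> forall i, P i;
  dsum_supp : fin_supp dsum_fun }.

HB.instance Definition _ := gen_eqMixin dsum.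
HB.instance Definition _ := gen_choiceMixin dsum.

Lemma dsum_ext (f g : dsum) : (forall i, f i = g i) -> f = g.
Proof.
case: f g => [f Ff] [g Fg] /= fg.
have e : f = g by apply: functional_extensionality_dep.
by case: _ / e Fg => Fg; rewrite (Prop_irrelevance Ff Fg).
Qed.

Lemma dsum0_subproof : fin_supp (fun i => 0 : P i).
Proof.
rewrite /fin_supp (_ : [set _ | _] = set0) //.
by rewrite -subset0 => i /=; rewrite eqxx.
Qed.

Lemma dsumN_subproof (f : dsum) : fin_supp (fun i => - f i).
Proof.
by apply: sub_finite_set (dsum_supp f) => i /=; rewrite oppr_eq0.
Qed.

Lemma dsumD_subproof (f g : dsum) : fin_supp (fun i => f i + g i).
Proof.
have : finite_set ([set i | f i != 0] `|` [set i | g i != 0]).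
  by rewrite finite_setU; split; apply: dsum_supp.
apply: sub_finite_set => i /=.
by case: (eqVneq (f i) 0) => [->|]; [rewrite add0r; right | left].
Qed.

Lemma dsumZ_subproof (a : A) (f : dsum) : fin_supp (fun i => a *: f i).
Proof.
apply: sub_finite_set (dsum_supp f) => i /=.
by apply: contraNN => /eqP->; rewrite scaler0.
Qed.

Definition dsum0 := DSum dsum0_subproof.
Definition dsumN f := DSum (dsumN_subproof f).
Definition dsumD f g := DSum (dsumD_subproof f g).
Definition dsumZ a f := DSum (dsumZ_subproof a f).

Lemma dsumDA : associative dsumD.
Proof. by move=> f g h; apply: dsum_ext => i /=; rewrite addrA. Qed.

Lemma dsumDC : commutative dsumD.
Proof. by move=> f g; apply: dsum_ext => i /=; rewrite addrC. Qed.

Lemma dsum0D : left_id dsum0 dsumD.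
Proof. by move=> f; apply: dsum_ext => i /=; rewrite add0r. Qed.

Lemma dsumND : left_inverse dsum0 dsumN dsumD.
Proof. by move=> f; apply: dsum_ext => i /=; rewrite addNr. Qed.

HB.instance Definition _ :=
  GRing.isZmodule.Build dsum dsumDA dsumDC dsum0D dsumND.

Lemma dsumZA a b f : dsumZ a (dsumZ b f) = dsumZ (a * b) f.
Proof. by apply: dsum_ext => i /=; rewrite scalerA. Qed.

Lemma dsum1Z : left_id 1 dsumZ.
Proof. by move=> f; apply: dsum_ext => i /=; rewrite scale1r. Qed.

Lemma dsumZDr : right_distributive dsumZ +%R.
Proof. by move=> a f g; apply: dsum_ext => i /=; rewrite scalerDr. Qed.

Lemma dsumZDl f : {morph dsumZ^~ f : a b / a + b}.
Proof. by move=> a b; apply: dsum_ext => i /=; rewrite scalerDl. Qed.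

HB.instance Definition _ :=
  GRing.Zmodule_isLmodule.Build A dsum dsumZA dsum1Z dsumZDr dsumZDl.

End DirectSum.

Section Ideals.
Variable R : comPzRingType.

Definition is_ideal (J : set R) : Prop :=
  [/\ J 0, forall a b, J a -> J b -> J (a + b) & forall r a, J a -> J (r * a)].

Definition is_prime (J : set R) : Prop :=
  [/\ is_ideal J, ~ J 1 & forall a b, J (a * b) -> J a \/ J b].

Definition is_maximal (J : set R) : Prop :=
  [/\ is_ideal J, ~ J 1 &
      forall K : set R, is_ideal K -> ~ K 1 -> J `<=` K -> K = J].

Record Spec : Type := MkSpec {
  spec_set :> set R;
  spec_prime : is_prime spec_set }.

Definition Max : set Spec := [set p : Spec | is_maximal p].

HB.instance Definition _ := gen_eqMixin Spec.
HB.instance Definition _ := gen_choiceMixin Spec.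

Definition zariski_closed (E : set R) : set Spec := [set p : Spec | E `<=` p].

Definition zariski_open : set_system Spec :=
  [set U | exists E : set R, U = ~` zariski_closed E].

Lemma zariski_openT : zariski_open setT.
Proof.
exists setT; apply/esym; rewrite -subTset => p _ /= Ep.
by have [_ + _] := spec_prime p; apply; apply: Ep.
Qed.

Lemma zariski_openI : setI_closed zariski_open.
Proof.
move=> _ _ [E ->] [F ->].
exists [set x | exists a b, [/\ E a, F b & x = a * b]].
rewrite -setCU; congr (~` _); apply/seteqP; split => p /=.
  have [[_ _ pM] _ _] := spec_prime p.
  by case=> EFp _ [a [b [Ea Fb ->]]]; [rewrite mulrC|]; apply/pM/EFp.
move=> EFp; apply: contrapT => /not_orP[].
move=> /existsNP[a /not_implyP[Ea pa]] /existsNP[b /not_implyP[Fb pb]].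
have [_ _ pP] := spec_prime p.
by have [|/pa|/pb] := pP a b; [apply: EFp; exists a, b|..].
Qed.

Lemma zariski_open_bigU (I : Type) (f : I -> set Spec) :
  (forall i, zariski_open (f i)) -> zariski_open (\bigcup_i f i).
Proof.
move=> fE; exists (\bigcup_(E in [set E | exists i, f i = ~` zariski_closed E]) E).
apply/seteqP; split => p /=.
  move=> [i _ fip] Ep; have [E fiE] := fE i.
  by move: fip; rewrite fiE; apply=> r Er; apply: Ep; exists E => //; exists i.
move=> /existsNP[r /not_implyP[[E [i fiE] Er] pr]].
by exists i => //; rewrite fiE => /(_ r Er).
Qed.

HB.instance Definition _ := isOpenTopological.Build Spec
  zariski_openT zariski_openI zariski_open_bigU.

End Ideals.

Section Dimension.
Variable T : topologicalType.

Definition noetherian_space : Prop :=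
  forall F : nat -> set T, (forall n, closed (F n)) ->
    (forall n, F n.+1 `<=` F n) ->
    exists n, forall m, (n <= m)%N -> F m = F n.

Definition irreducible (Z : set T) : Prop :=
  Z !=set0 /\ forall A B : set T, closed A -> closed B ->
    Z `<=` A `|` B -> Z `<=` A \/ Z `<=` B.

(* F 0, ..., F n is a strictly increasing chain; the values of F beyond n
   are irrelevant. *)
Definition irreducible_chain (n : nat) (F : nat -> set T) : Prop :=
  (forall i, (i <= n)%N -> closed (F i) /\ irreducible (F i)) /\
  (forall i, (i < n)%N -> F i `<` F i.+1).

(* The default value -oo of supremum is attained only on the empty set,
   i.e. only when T is empty. *)
Definition krull_dim : \bar int :=
  supremum -oo%E [set n%:Z%:E%E | n in [set n : nat |
    exists F : nat -> set T, irreducible_chain n F]].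

End Dimension.

Section Localization.
Variables (R : comPzRingType) (p : Spec R).

Record denom : Type := Denom { dval : R; dvalP : ~ (p : set R) dval }.

HB.instance Definition _ := gen_eqMixin denom.
HB.instance Definition _ := gen_choiceMixin denom.

Lemma denom1_subproof : ~ (p : set R) 1.
Proof. by have [] := spec_prime p. Qed.

Lemma denomM_subproof (u v : denom) : ~ (p : set R) (dval u * dval v).
Proof.
by have [_ _ pP] := spec_prime p; move=> /pP[]; apply: dvalP.
Qed.

Definition denom1 : denom := Denom denom1_subproof.
Definition denomM (u v : denom) : denom := Denom (@denomM_subproof u v).

Section Module.
Variable V : lmodType R.

Definition frac_eq (x y : V * denom) : bool :=
  `[< exists w : denom,
      dval w *: (dval y.2 *: x.1) = dval w *: (dval x.2 *: y.1) >].

Lemma frac_eq_refl : reflexive frac_eq.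
Proof. by move=> x; apply/asboolP; exists denom1. Qed.

Lemma frac_eq_sym : symmetric frac_eq.
Proof. by move=> x y; apply/asboolP/asboolP => -[w E]; exists w. Qed.

Lemma frac_eq_trans : transitive frac_eq.
Proof.
move=> [y b] [x a] [z c] /asboolP[w /= E] /asboolP[w' /= E'].
apply/asboolP; exists (denomM (denomM w w') b) => /=.
have -> : dval w * dval w' * dval b *: (dval c *: x) =
          (dval w' * dval c) *: (dval w *: (dval b *: x)).
  by rewrite !scalerA; congr (_ *: _); ring.
have -> : dval w * dval w' * dval b *: (dval a *: z) =
          (dval w * dval a) *: (dval w' *: (dval b *: z)).
  by rewrite !scalerA; congr (_ *: _); ring.
by rewrite E -E' !scalerA; congr (_ *: _); ring.
Qed.

Canonical frac_equiv :=
  EquivRel frac_eq frac_eq_refl frac_eq_sym frac_eq_trans.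

Definition loc : Type := {eq_quot frac_eq}.

HB.instance Definition _ := Choice.on loc.

Definition lfrac (v : V) (u : denom) : loc := \pi_({eq_quot frac_eq}) (v, u).

Lemma frac_eqP v u v' u' :
  lfrac v u = lfrac v' u' <->
  exists w : denom, dval w *: (dval u' *: v) = dval w *: (dval u *: v').
Proof.
split; first by move=> /eqquotP /asboolP.
by move=> E; apply/eqquotP/asboolP.
Qed.

Definition lnum (x : loc) : V := (repr (x : {eq_quot frac_eq})).1.
Definition lden (x : loc) : denom := (repr (x : {eq_quot frac_eq})).2.

Lemma fracK x : lfrac (lnum x) (lden x) = x.
Proof. by rewrite /lfrac /lnum /lden -surjective_pairing reprK. Qed.

Lemma lnum_lden v u : exists w : denom,
  dval w *: (dval u *: lnum (lfrac v u)) = dval w *: (dval (lden (lfrac v u)) *: v).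
Proof. exact/frac_eqP/fracK. Qed.

Lemma locP (Q : loc -> Prop) : (forall v u, Q (lfrac v u)) -> forall x, Q x.
Proof. by move=> QP x; rewrite -(fracK x). Qed.

Definition loc_zero : loc := lfrac 0 denom1.
Definition loc_opp (x : loc) : loc := lfrac (- lnum x) (lden x).
Definition loc_add (x y : loc) : loc :=
  lfrac (dval (lden y) *: lnum x + dval (lden x) *: lnum y)
       (denomM (lden x) (lden y)).

Lemma loc_oppE v u : loc_opp (lfrac v u) = lfrac (- v) u.
Proof.
apply/frac_eqP; have [w E] := lnum_lden v u; exists w.
by rewrite !scalerN E.
Qed.

Lemma loc_addE v u v' u' :
  loc_add (lfrac v u) (lfrac v' u') =
  lfrac (dval u' *: v + dval u *: v') (denomM u u').
Proof.
apply/frac_eqP; have [w] := lnum_lden v u; have [w'] := lnum_lden v' u'.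
rewrite /=.
move: (lnum _) (lden _) (lnum _) (lden _) => n d n' d' E' E.
exists (denomM w w') => /=; rewrite !scalerDr; congr (_ + _).
  transitivity ((dval w' * dval u' * dval d') *: (dval w *: (dval u *: n))).
    by rewrite !scalerA; congr (_ *: _); ring.
  by rewrite E !scalerA; congr (_ *: _); ring.
transitivity ((dval w * dval u * dval d) *: (dval w' *: (dval u' *: n'))).
  by rewrite !scalerA; congr (_ *: _); ring.
by rewrite E' !scalerA; congr (_ *: _); ring.
Qed.

Lemma frac_scale (w : denom) v u : lfrac (dval w *: v) (denomM w u) = lfrac v u.
Proof.
by apply/frac_eqP; exists denom1; rewrite /= !scalerA; congr (_ *: _); ring.
Qed.

Lemma loc_addA : associative loc_add.
Proof.
elim/locP=> x a; elim/locP=> y b; elim/locP=> z c.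
rewrite !loc_addE; apply/frac_eqP; exists denom1 => /=.
rewrite !scalerDr !scalerA -!addrA; congr (_ + (_ + _)).
- by congr (_ *: _); ring.
- by congr (_ *: _); ring.
- by congr (_ *: _); ring.
Qed.

Lemma loc_addC : commutative loc_add.
Proof.
elim/locP=> x a; elim/locP=> y b; rewrite !loc_addE.
apply/frac_eqP; exists denom1 => /=.
by rewrite addrC [dval b * _]mulrC.
Qed.

Lemma loc_add0 : left_id loc_zero loc_add.
Proof.
elim/locP=> x a; rewrite loc_addE /= scaler0 add0r.
by rewrite -[RHS](frac_scale denom1).
Qed.

Lemma loc_addN : left_inverse loc_zero loc_opp loc_add.
Proof.
elim/locP=> x a; rewrite loc_oppE loc_addE scalerN addNr.
by apply/frac_eqP; exists denom1; rewrite /= !scaler0.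
Qed.

HB.instance Definition _ :=
  GRing.isZmodule.Build loc loc_addA loc_addC loc_add0 loc_addN.

Lemma addfE v u v' u' :
  lfrac v u + lfrac v' u' = lfrac (dval u' *: v + dval u *: v') (denomM u u').
Proof. exact: loc_addE. Qed.

Lemma addf_same v v' u : lfrac v u + lfrac v' u = lfrac (v + v') u.
Proof. by rewrite addfE -scalerDr frac_scale. Qed.

End Module.

(* An R-bilinear map B induces (u / a, v / b) |-> B u v / (a b). *)
Section Bilinear.
Variables (U V W : lmodType R) (B : U -> V -> W).
Hypothesis BZl : forall r u v, B (r *: u) v = r *: B u v.
Hypothesis BZr : forall r u v, B u (r *: v) = r *: B u v.

Definition loc_bil (x : loc U) (y : loc V) : loc W :=
  lfrac (B (lnum x) (lnum y)) (denomM (lden x) (lden y)).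

Lemma loc_bilE u a v b :
  loc_bil (lfrac u a) (lfrac v b) = lfrac (B u v) (denomM a b).
Proof.
apply/frac_eqP; have [w] := lnum_lden u a; have [w'] := lnum_lden v b.
rewrite /=.
move: (lnum _) (lden _) (lnum _) (lden _) => n d n' d' E' E.
exists (denomM w w') => /=.
transitivity (B (dval w *: (dval a *: n)) (dval w' *: (dval b *: n'))).
  by rewrite !(BZl, BZr) !scalerA; congr (_ *: _); ring.
by rewrite E E' !(BZl, BZr) !scalerA; congr (_ *: _); ring.
Qed.

Hypothesis BDl : forall u u' v, B (u + u') v = B u v + B u' v.
Hypothesis BDr : forall u v v', B u (v + v') = B u v + B u v'.

Lemma loc_bilDl x x' y : loc_bil (x + x') y = loc_bil x y + loc_bil x' y.
Proof.
elim/locP: x => u a; elim/locP: x' => u' a'; elim/locP: y => v b.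
rewrite addfE !loc_bilE addfE BDl !BZl; apply/frac_eqP; exists denom1 => /=.
by rewrite !scalerDr !scalerA; congr (_ *: _ + _ *: _); ring.
Qed.

Lemma loc_bilDr x y y' : loc_bil x (y + y') = loc_bil x y + loc_bil x y'.
Proof.
elim/locP: x => u a; elim/locP: y => v b; elim/locP: y' => v' b'.
rewrite addfE !loc_bilE addfE BDr !BZr; apply/frac_eqP; exists denom1 => /=.
by rewrite !scalerDr !scalerA; congr (_ *: _ + _ *: _); ring.
Qed.

End Bilinear.

End Localization.

(* The library's algType requires a nonzero ring, so an R-algebra is given
   here by its structure map, a ring morphism with central image. *)
Record algebra_map (R : comPzRingType) (S : pzRingType) := AlgebraMap {
  amap :> {rmorphism R -> S};
  amap_central : forall r s, amap r * s = s * amap r }.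

Section Algebra.
Variables (R : comPzRingType) (S : pzRingType) (phi : algebra_map R S).

(* S as an R-module. *)
Definition alg_mod (_ : algebra_map R S) : Type := S.
Local Notation S_R := (alg_mod phi).

HB.instance Definition _ := GRing.Zmodule.on S_R.

Definition alg_scale (r : R) (s : S_R) : S_R := phi r * (s : S).

Lemma alg_scaleA a b s : alg_scale a (alg_scale b s) = alg_scale (a * b) s.
Proof. by rewrite /alg_scale rmorphM mulrA. Qed.

Lemma alg_scale1 : left_id 1 alg_scale.
Proof. by move=> s; rewrite /alg_scale rmorph1 mul1r. Qed.

Lemma alg_scaleDr : right_distributive alg_scale +%R.
Proof. by move=> r s t; rewrite /alg_scale mulrDr. Qed.

Lemma alg_scaleDl s : {morph alg_scale^~ s : a b / a + b}.
Proof. by move=> a b; rewrite /alg_scale rmorphD mulrDl. Qed.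

HB.instance Definition _ := GRing.Zmodule_isLmodule.Build R S_R
  alg_scaleA alg_scale1 alg_scaleDr alg_scaleDl.

Definition module_finite : Prop := finitely_generated S_R.

(* A right S-module M as an R-module. *)
Definition res_mod (_ : algebra_map R S) (M : Type) : Type := M.

Section Restriction.
Variable M : lmodType S^c.
Local Notation M_R := (res_mod phi M).

HB.instance Definition _ := GRing.Zmodule.on M_R.

Definition res_scale (r : R) (m : M_R) : M_R := (phi r : S^c) *: (m : M).

Lemma res_scaleA a b m : res_scale a (res_scale b m) = res_scale (a * b) m.
Proof. by rewrite /res_scale scalerA [a * b]mulrC rmorphM. Qed.

Lemma res_scale1 : left_id 1 res_scale.
Proof. by move=> m; rewrite /res_scale rmorph1 scale1r. Qed.

Lemma res_scaleDr : right_distributive res_scale +%R.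
Proof. by move=> r m n; rewrite /res_scale scalerDr. Qed.

Lemma res_scaleDl m : {morph res_scale^~ m : a b / a + b}.
Proof. by move=> a b; rewrite /res_scale rmorphD scalerDl. Qed.

HB.instance Definition _ := GRing.Zmodule_isLmodule.Build R M_R
  res_scaleA res_scale1 res_scaleDr res_scaleDl.

End Restriction.

Variable p : Spec R.

Definition loc_ring : Type := loc p S_R.

HB.instance Definition _ := GRing.Zmodule.on loc_ring.

Definition alg_mul (s t : S_R) : S_R := (s : S) * (t : S).

Lemma alg_mulZl r s t : alg_mul (r *: s) t = r *: alg_mul s t.
Proof. exact/esym/mulrA. Qed.

Lemma alg_mulZr r s t : alg_mul s (r *: t) = r *: alg_mul s t.
Proof.
by rewrite /alg_mul -![_ *: _]/(phi r * _) mulrA -amap_central mulrA.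
Qed.

(* (s / u) (t / v) = (s t) / (u v) *)
Definition loc_mul (x y : loc_ring) : loc_ring := loc_bil alg_mul x y.
Definition loc_one : loc_ring := lfrac ((1 : S) : S_R) (denom1 p).

Lemma loc_mulE s u t v : loc_mul (lfrac s u) (lfrac t v) =
  lfrac (((s : S) * (t : S)) : S_R) (denomM u v).
Proof. exact: (loc_bilE alg_mulZl alg_mulZr). Qed.

Lemma loc_mulA : associative loc_mul.
Proof.
elim/locP=> x a; elim/locP=> y b; elim/locP=> z c; rewrite !loc_mulE.
by apply/frac_eqP; exists (denom1 p); rewrite /= !mulrA.
Qed.

Lemma loc_mul1l : left_id loc_one loc_mul.
Proof.
elim/locP=> x a; rewrite loc_mulE mul1r.
by apply/frac_eqP; exists (denom1 p); rewrite /= mul1r.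
Qed.

Lemma loc_mul1r : right_id loc_one loc_mul.
Proof.
elim/locP=> x a; rewrite loc_mulE mulr1.
by apply/frac_eqP; exists (denom1 p); rewrite /= mulr1.
Qed.

Lemma loc_mulDl : left_distributive loc_mul +%R.
Proof. by move=> x y z; apply: (loc_bilDl alg_mulZl alg_mulZr) => *; apply: mulrDl. Qed.

Lemma loc_mulDr : right_distributive loc_mul +%R.
Proof. by move=> x y z; apply: (loc_bilDr alg_mulZl alg_mulZr) => *; apply: mulrDr. Qed.

HB.instance Definition _ := GRing.Zmodule_isPzRing.Build loc_ring
  loc_mulA loc_mul1l loc_mul1r loc_mulDl loc_mulDr.

Section LocModule.
Variable M : lmodType S^c.
Local Notation M_R := (res_mod phi M).

Definition loc_mod : Type := loc p M_R.

HB.instance Definition _ := GRing.Zmodule.on loc_mod.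

Definition res_act (s : S_R) (m : M_R) : M_R := (s : S^c) *: (m : M).

Lemma res_actZl r s m : res_act (r *: s) m = r *: res_act s m.
Proof.
rewrite /res_act -[r *: s]/(phi r * (s : S)) -[RHS]/((phi r : S^c) *: _) scalerA.
by rewrite amap_central.
Qed.

Lemma res_actZr r s m : res_act s (r *: m) = r *: res_act s m.
Proof.
rewrite /res_act -[r *: m]/((phi r : S^c) *: (m : M)).
rewrite -[RHS]/((phi r : S^c) *: _) !scalerA.
exact: (congr1 (fun x : S^c => x *: (m : M)) (amap_central phi r s)).
Qed.

(* (m / v) (s / u) = (m s) / (u v) *)
Definition loc_scale (x : loc_ring^c) (y : loc_mod) : loc_mod := loc_bil res_act x y.

Lemma loc_scaleE s u m v : loc_scale (lfrac s u) (lfrac m v) =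
  lfrac (((s : S^c) *: (m : M)) : M_R) (denomM u v).
Proof. exact: (loc_bilE res_actZl res_actZr). Qed.

Lemma loc_scaleA x y m :
  loc_scale x (loc_scale y m) = loc_scale (x * y) m.
Proof.
elim/locP: x => s u; elim/locP: y => t v; elim/locP: m => m w.
rewrite -[_ * _]/(loc_mul (lfrac t v) (lfrac s u)) loc_mulE !loc_scaleE scalerA.
apply/frac_eqP; exists (denom1 p) => /=; congr (_ *: (_ *: _)); ring.
Qed.

Lemma loc_scale1 : left_id 1 loc_scale.
Proof.
elim/locP=> m w; rewrite -[1]/loc_one loc_scaleE scale1r.
by apply/frac_eqP; exists (denom1 p); rewrite /= mul1r.
Qed.

Lemma loc_scaleDr : right_distributive loc_scale +%R.
Proof. by move=> x y z; apply: (loc_bilDr res_actZl res_actZr) => *; apply: (@scalerDr _ M). Qed.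

Lemma loc_scaleDl m : {morph loc_scale^~ m : x y / x + y}.
Proof. by move=> x y; apply: (loc_bilDl res_actZl res_actZr) => *; apply: (@scalerDl _ M). Qed.

HB.instance Definition _ := GRing.Zmodule_isLmodule.Build loc_ring^c loc_mod
  loc_scaleA loc_scale1 loc_scaleDr loc_scaleDl.

End LocModule.

End Algebra.

Definition Supp (R : comPzRingType) (S : pzRingType) (phi : algebra_map R S)
    (N : lmodType S^c) : set (Spec R) :=
  [set p | exists x : loc_mod phi p N, x != 0].

Definition sur_at (R : comPzRingType) (S : pzRingType) (phi : algebra_map R S)
    (p : Spec R) (M N : lmodType S^c) : \bar int :=
  @sur (loc_ring phi p)^c (loc_mod phi p M) (loc_mod phi p N).

(* The least element of a set; it exists for every nonempty set of values of
   sur, since these lie in {0, 1, 2, ..., +oo}. *)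
Definition emin (E : set (\bar int)) : \bar int := xget +oo%E (E `&` lbound E).

(* Main.v *)
(* General position, after Eisenbud and Evans. By finite presentation, a
   surjection M_m -> N_m^n lifts, up to units, to homomorphisms M -> N, and as Y
   is Noetherian finitely many homomorphisms f_1, ..., f_s : M -> N induce the
   required surjections at all m in Y. One then lowers s to t while keeping the
   following condition: on every irreducible closed Z in Y, the R-combinations of
   the f_i give a surjection onto N^(min(s, t + dim Z)) at some point of Z. To
   pass from s + 1 to s, drop f_0 after replacing it by f_0' = f_0 + sum b_i f_i
   and each other f_i by f_i + a_i f_0'. This lowers the number of copies of N
   reached at a point by at most one, and not at all at one given point for a
   suitable choice of a and b. The only Z that can go wrong are components of the
   closed sets where at most t + k copies of N are reached; they are finitely
   many, and a and b are chosen by the Chinese remainder theorem at one point of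
   each. When s = t the points of Y are covered, and Nakayama's lemma concludes.
   Everything after the lifting takes place in the R-module N^s, for the image
   L of M. *)
Require Import Defs.
From HB Require Import structures.
From mathcomp Require Import all_boot all_order all_algebra.
From mathcomp Require Import all_classical constructive_ereal topology.
From mathcomp Require Import ring zify.

Set Implicit Arguments.
Unset Strict Implicit.
Unset Printing Implicit Defensive.

Import Order.TTheory GRing.Theory Num.Theory.

Local Open Scope classical_set_scope.
Local Open Scope ring_scope.

(** * Linear algebra modulo a maximal ideal *)

Section MaximalIdeals.
Variable R : comPzRingType.
Implicit Types (J : set R).

Lemma ideal0 J : is_ideal J -> J 0. Proof. by case. Qed.

Lemma idealD J a b : is_ideal J -> J a -> J b -> J (a + b).
Proof. by case=> _ + _; apply. Qed.

Lemma idealMl J r a : is_ideal J -> J a -> J (r * a).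
Proof. by case=> _ _; apply. Qed.

Lemma idealMr J r a : is_ideal J -> J a -> J (a * r).
Proof. by rewrite mulrC; apply: idealMl. Qed.

Lemma idealN J a : is_ideal J -> J a -> J (- a).
Proof. by rewrite -mulN1r; apply: idealMl. Qed.

Lemma idealB J a b : is_ideal J -> J a -> J b -> J (a - b).
Proof. by move=> iJ Ja Jb; apply: idealD => //; apply: idealN. Qed.

Lemma ideal_sum J (I : Type) (r : seq I) (P : pred I) (F : I -> R) :
  is_ideal J -> (forall i, P i -> J (F i)) -> J (\sum_(i <- r | P i) F i).
Proof.
move=> iJ JF; elim/big_ind: _ => //; first exact: ideal0.
by move=> a b; apply: idealD.
Qed.

Lemma max_ideal J : is_maximal J -> is_ideal J. Proof. by case. Qed.

Lemma max_proper J : is_maximal J -> ~ J 1. Proof. by case. Qed.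

(** Otherwise J + Rc is a proper ideal above J, hence equal to J, although it contains c. *)
Lemma max_inv J c : is_maximal J -> ~ J c -> exists w, J (1 - w * c).
Proof.
move=> [iJ J1 Jmax] Jc; apply: contrapT => /forallNP nw.
pose K : set R := [set x | exists r, J (x - r * c)].
have iK : is_ideal K.
  split; first by exists 0; rewrite mul0r subr0; apply: ideal0.
    move=> a b [r Jr] [s Js]; exists (r + s).
    by rewrite mulrDl opprD addrACA; apply: idealD.
  by move=> r a [s Js]; exists (r * s); rewrite -mulrA -mulrBr; apply: idealMl.
have KJ : K = J.
  apply: Jmax => // [[r] /nw//|x Jx].
  by exists 0; rewrite mul0r subr0.
by apply: Jc; rewrite -KJ; exists 1; rewrite mul1r subrr; apply: ideal0.
Qed.

Lemma max_prime J : is_maximal J -> is_prime J.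
Proof.
move=> mJ; have iJ := max_ideal mJ; split=> //; first exact: max_proper.
move=> a b Jab; apply: contrapT => /not_orP[/(max_inv mJ)[w Jw]]; apply.
have -> : b = (1 - w * a) * b + w * (a * b) by ring.
by apply: idealD => //; [apply: idealMr | apply: idealMl].
Qed.

Lemma max_exists J : is_ideal J -> ~ J 1 ->
  exists2 K, is_maximal K & J `<=` K.
Proof.
move=> iJ J1.
pose P (X : set R) := [/\ is_ideal X, ~ X 1 & J `<=` X].
(* Zorn's lemma also asks about the empty chain, whose union is empty; uniting with [J] turns that
   case into the ideal [J]. *)
have [F FP totF|A [[iA A1 JA] Amax]] := @Zorn_bigcup R (fun X => P (J `|` X)).
  have [F0|/set0P[X0 FX0]] := eqVneq F set0.
    by rewrite F0 bigcup_set0 setU0; split.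
  split; last by move=> x; left.
    split; first by left; apply: ideal0.
      have key X a b : F X -> (J `|` X) a -> (J `|` X) b ->
          (J `|` \bigcup_(X in F) X) (a + b).
        move=> FX Xa Xb; have [iX _ _] := FP _ FX.
        by case: (idealD iX Xa Xb) => [|Xab]; [left | right; exists X].
      move=> a b [Ja|[X FX Xa]] [Jb|[X' FX' Xb]].
      + by apply: (key X0) => //; left.
      + by apply: (key X') => //; [left | right].
      + by apply: (key X) => //; [right | left].
      + have [XX'|X'X] := totF _ _ FX FX'.
          by apply: (key X') => //; right => //; apply: XX'.
        by apply: (key X) => //; right => //; apply: X'X.
    move=> r a [Ja|[X FX Xa]]; first by left; apply: idealMl.
    have [iX _ _] := FP _ FX.
    by case: (@idealMl _ r a iX (or_intror Xa)) => [|Xra]; [left | right; exists X].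
  by case=> // -[X FX X1]; have [_ + _] := FP _ FX; apply; right.
exists (J `|` A) => //; split=> // K iK K1 JAK.
have JK : J `<=` K by apply: subset_trans JAK; apply: subsetUl.
apply: contrapT => KJA; apply: (Amax K).
  split; last by move=> KA; apply: KJA; apply/seteqP; split=> // x /KA; right.
  by apply: subset_trans JAK; apply: subsetUr.
by rewrite /P setUidr.
Qed.

Lemma max_comaximal J K : is_maximal J -> is_maximal K -> J <> K ->
  exists e, J e /\ K (1 - e).
Proof.
move=> mJ mK JK; have [e Je Ke] : exists2 e, J e & ~ K e.
  apply: contrapT => /forall2NP nJK; apply/JK/esym; case: mJ => iJ J1; apply.
  - exact: max_ideal.
  - exact: max_proper.
  - by move=> x Jx; have [|/contrapT] := nJK x.
have [w Kw] := max_inv mK Ke.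
by exists (w * e); split=> //; apply: idealMl => //; apply: max_ideal.
Qed.

(** Linear algebra over the field R/J is carried out on matrices over R up to this congruence, so
    that the same matrices act on R-modules. *)
Definition eqmx_mod J (p q : nat) (A B : 'M[R]_(p, q)) :=
  forall i j, J (A i j - B i j).

Lemma eqmx_mod_refl J p q (A : 'M[R]_(p, q)) : is_ideal J -> eqmx_mod J A A.
Proof. by move=> iJ i j; rewrite subrr; apply: ideal0. Qed.

Lemma eqmx_mod_sym J p q (A B : 'M[R]_(p, q)) :
  is_ideal J -> eqmx_mod J A B -> eqmx_mod J B A.
Proof. by move=> iJ AB i j; rewrite -opprB; apply: idealN. Qed.

Lemma eqmx_mod_trans J p q (A B C : 'M[R]_(p, q)) :
  is_ideal J -> eqmx_mod J A B -> eqmx_mod J B C -> eqmx_mod J A C.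
Proof.
move=> iJ AB BC i j; have -> : A i j - C i j = (A i j - B i j) + (B i j - C i j).
  by rewrite addrA subrK.
exact: idealD.
Qed.

Lemma eqmx_modD J p q (A B A' B' : 'M[R]_(p, q)) :
  is_ideal J -> eqmx_mod J A A' -> eqmx_mod J B B' -> eqmx_mod J (A + B) (A' + B').
Proof.
move=> iJ AA BB i j; rewrite !mxE.
by rewrite opprD addrACA; apply: idealD.
Qed.

Lemma eqmx_modM J p q r (A A' : 'M[R]_(p, q)) (B B' : 'M[R]_(q, r)) :
  is_ideal J -> eqmx_mod J A A' -> eqmx_mod J B B' ->
  eqmx_mod J (A *m B) (A' *m B').
Proof.
move=> iJ AA BB i j; rewrite !mxE -sumrB; apply: ideal_sum => // k _.
have -> : A i k * B k j - A' i k * B' k j =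
  (A i k - A' i k) * B k j + A' i k * (B k j - B' k j) by ring.
by apply: idealD => //; [apply: idealMr | apply: idealMl].
Qed.

Lemma eqmx_mod_row J p q r (A A' : 'M[R]_(p, q)) (B B' : 'M[R]_(p, r)) :
  eqmx_mod J A A' -> eqmx_mod J B B' ->
  eqmx_mod J (row_mx A B) (row_mx A' B').
Proof. by move=> AA BB i j; rewrite !mxE; case: splitP. Qed.

(* The target depends on the ideal itself, so that no distinctness is required
   from the list. *)
Lemma chinese_mx p q (s : seq (set R)) (G : set R -> 'M[R]_(p, q)) :
  (forall J, J \in s -> is_maximal J) ->
  exists A, forall J, J \in s -> eqmx_mod J A (G J).
Proof.
elim: s => [|J s IHs] ms; first by exists 0.
have mJ : is_maximal J by apply: ms; rewrite mem_head.
have ms' K : K \in s -> is_maximal K by move=> Ks; apply: ms; rewrite inE Ks orbT.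
have [A AG] := IHs ms'.
have [Js|Js] := boolP (J \in s).
  by exists A => K; rewrite inE => /orP[/eqP->|]; apply: AG.
(* A product of factors, one from each comaximal pair; it interpolates between [A] and [G J]
   below. *)
have [e [eJ es]] : exists e, J (1 - e) /\ forall K, K \in s -> K e.
  elim: s ms' Js {IHs ms AG} => [|K s IHs] ms Js.
    exists 1; split=> [|K]; last by rewrite in_nil.
    by rewrite subrr; apply: ideal0; apply: max_ideal.
  have [||e [Je es]] := IHs.
  - by move=> L Ls; apply: ms; rewrite inE Ls orbT.
  - by apply: contraNN Js; rewrite inE orbC => ->.
  have mK : is_maximal K by apply: ms; rewrite mem_head.
  have [|f [Kf Jf]] := max_comaximal mK mJ.
    by move=> KJ; move: Js; rewrite KJ mem_head.
  exists (e * f); split.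
    have -> : 1 - e * f = (1 - e) + e * (1 - f) by ring.
    have iJ := max_ideal mJ; by apply: idealD => //; apply: idealMl.
  move=> L; rewrite inE => /orP[/eqP->|Ls].
    by apply: idealMl => //; apply: max_ideal.
  apply: idealMr; last exact: es.
  by apply: max_ideal; apply: ms; rewrite inE Ls orbT.
exists (A + e *: (G J - A)) => K; rewrite inE => /orP[/eqP->|Ks] i j; rewrite !mxE.
  have -> : A i j + e * (G J i j - A i j) - G J i j =
    (1 - e) * (A i j - G J i j) by ring.
  by apply: idealMr => //; apply: max_ideal.
rewrite addrAC; apply: idealD; first by apply: max_ideal; apply: ms'.
  exact: AG.
by apply: idealMr; [apply: max_ideal; apply: ms' | exact: es].
Qed.

(* One step of Gaussian elimination modulo J; D witnesses that C has full rank. *)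
Lemma max_elim k J (c : 'cV[R]_k.+1) : is_maximal J ->
  exists (C : 'M[R]_(k, k.+1)) (D : 'M[R]_(k.+1, k)),
    C *m D = 1%:M /\ eqmx_mod J (C *m c) 0.
Proof.
move=> mJ; have iJ := max_ideal mJ.
(* [i] is a pivot and [w] inverts [c i 0]; if [c] vanishes modulo [J], then [w = 0] will do. *)
have [i [w ciw]] : exists i w, forall j, J (c j 0 - w * c i 0 * c j 0).
  have [[i ci]|/forallNP Jc] := pselect (exists i, ~ J (c i 0)).
    have [w Jw] := max_inv mJ ci; exists i, w => j.
    have -> : c j 0 - w * c i 0 * c j 0 = (1 - w * c i 0) * c j 0 by ring.
    exact: idealMr.
  by exists 0, 0 => j; rewrite !mul0r subr0; apply: contrapT; apply: Jc.
(* Row j of [C] takes the entry [lift i j] and subtracts [w * c (lift i j) 0] times the pivot entry;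
   [D] reinserts a zero at the pivot. *)
exists (\matrix_(j, l) ((lift i j == l)%:R - (l == i)%:R * (w * c (lift i j) 0))).
exists (\matrix_(l, j) (lift i j == l)%:R); split.
  apply/matrixP => j l; rewrite !mxE (bigD1 (lift i l)) //= !mxE eqxx mulr1.
  rewrite [lift i l == i]eq_sym (negPf (neq_lift _ _)) mul0r subr0.
  rewrite (inj_eq lift_inj) big1 ?addr0 // => m ml.
  by rewrite !mxE [lift i l == m]eq_sym (negPf ml) mulr0.
move=> j j'; rewrite ord1 !mxE subr0 (bigD1 (lift i j)) //= (bigD1 i) /=; last first.
  by rewrite neq_lift.
rewrite big1 => [|l /andP[lj li]]; last first.
  by rewrite !mxE [lift i j == l]eq_sym (negPf lj) (negPf li) mul0r subrr mul0r.
rewrite !mxE eqxx [lift i j == i]eq_sym (negPf (neq_lift _ _)) eqxx.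
rewrite !mul0r !mul1r subr0 addr0 sub0r mul1r mulNr.
have -> : w * c (lift i j) 0 * c i 0 = w * c i 0 * c (lift i j) 0 by ring.
exact: ciw.
Qed.

(** Induction on the number of rows: the columns of [C^T] solve the first equation, and [D] shows
    that a nonzero combination of them, found for the other equations, stays nonzero. *)
Lemma max_kernel J k n (A : 'M[R]_(k, n)) : is_maximal J -> (k < n)%N ->
  exists x : 'cV[R]_n, (exists i, ~ J (x i 0)) /\ eqmx_mod J (A *m x) 0.
Proof.
move=> mJ; have iJ := max_ideal mJ; elim: k n A => [|k IHk] [//|n] A kn.
  exists (const_mx 1); split; last by case.
  by exists 0; rewrite mxE; apply: max_proper.
have [C [D [CD Ac]]] := max_elim (usubmx (A : 'M_(1 + k, _)))^T mJ.
have [x [[i xi] Ax]] := IHk _ (dsubmx (A : 'M_(1 + k, _)) *m C^T) kn.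
exists (C^T *m x); split.
  apply: contrapT => /forallNP JCx; apply: xi.
  have -> : x = D^T *m (C^T *m x) by rewrite mulmxA -trmx_mul CD trmx1 mul1mx.
  rewrite mxE; apply: ideal_sum => // l _; apply: idealMl => //.
  by apply: contrapT; apply: JCx.
rewrite mulmxA => i' j; rewrite [X in _ - X]mxE subr0.
have [i1|i1] := splitP (i' : 'I_(1 + k)) => i'E.
  have -> : i' = lshift k i1 :> 'I_(1 + k) by apply: val_inj.
  rewrite mxE; apply: ideal_sum => // l _; apply: idealMr => //.
  have := Ac l i1; rewrite !mxE subr0; congr J.
  by apply: eq_bigr => m _; rewrite !mxE mulrC.
have -> : i' = rshift 1 i1 :> 'I_(1 + k) by apply: val_inj.
have := Ax i1 j; rewrite [X in _ - X]mxE subr0; congr J; rewrite !mxE.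
apply: eq_bigr => l _; congr (_ * _); rewrite !mxE.
by apply: eq_bigr => m _; rewrite !mxE.
Qed.

End MaximalIdeals.

(** * Nakayama's lemma *)

Section Nakayama.
Variable R : comPzRingType.
Implicit Types (J : set R) (V W : lmodType R).

(* J V, as the intersection of the additive subgroups containing all c v. *)
Definition imul J V (z : V) := forall Q : set V,
  Q 0 -> (forall x y, Q x -> Q y -> Q (x + y)) ->
  (forall c y, J c -> Q (c *: y)) -> Q z.

Lemma imul0 J V : imul J (0 : V). Proof. by []. Qed.

Lemma imulD J V (x y : V) : imul J x -> imul J y -> imul J (x + y).
Proof. by move=> Jx Jy Q Q0 QD QJ; apply: (QD); [exact: Jx | exact: Jy]. Qed.

Lemma imulZ J V c (x : V) : J c -> imul J (c *: x).
Proof. by move=> Jc Q _ _; apply. Qed.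

Lemma imul_sum J V (I : Type) (r : seq I) (F : I -> V) :
  (forall i, imul J (F i)) -> imul J (\sum_(i <- r) F i).
Proof.
move=> JF; elim/big_ind: _ => [|x y|i _]; first exact: imul0.
  exact: imulD.
exact: JF.
Qed.

Lemma imul_map J V W (f : V -> W) : f 0 = 0 -> {morph f : x y / x + y} ->
  (forall c x, f (c *: x) = c *: f x) -> forall x, imul J x -> imul J (f x).
Proof.
move=> f0 fD fZ x Jx; apply: (Jx (fun x => imul J (f x))) => [|y z Jy Jz|c y Jc].
- by rewrite f0; apply: imul0.
- by rewrite fD; apply: imulD.
- by rewrite fZ; apply: imulZ.
Qed.

Lemma imul_scale J V r (x : V) : imul J x -> imul J (r *: x).
Proof.
apply: (@imul_map J V V ( *:%R r)); first exact: scaler0.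
  exact: scalerDr.
by move=> c y; rewrite !scalerA mulrC.
Qed.

Lemma imulN J V (x : V) : imul J x -> imul J (- x).
Proof. by rewrite -scaleN1r; apply: imul_scale. Qed.

Definition submod V (L : set V) :=
  [/\ L 0, forall x y, L x -> L y -> L (x + y) & forall c x, L x -> L (c *: x)].

Definition generates V (I : finType) (g : I -> V) :=
  forall v, exists c : I -> R, v = \sum_i c i *: g i.

(** That is, L + J V = V. *)
Definition onto_mod J V (L : set V) := forall v, exists2 z, L z & imul J (v - z).

Definition adjoin V (L : set V) (y : V) : set V := [set v | exists a, L (v - a *: y)].

Lemma submod_adjoin V (L : set V) y : submod L -> submod (adjoin L y).
Proof.
move=> [L0 LD LZ]; split=> [|u v [a La] [b Lb]|c u [a La]].
- by exists 0; rewrite scale0r subr0.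
- by exists (a + b); rewrite scalerDl opprD addrACA; apply: LD.
- by exists (c * a); rewrite -scalerA -scalerBr; apply: LZ.
Qed.

Lemma adjoin_sum V (I : Type) (r : seq I) (g : I -> V) (c : I -> R) (L : set V) v :
  L (v - \sum_(i <- r) c i *: g i) -> foldl (@adjoin V) L (map g r) v.
Proof.
elim: r L v => [|i r IHr] L v; first by rewrite big_nil subr0.
rewrite big_cons => Lv; apply: IHr; exists (c i).
by rewrite -addrA -opprD [X in - X]addrC.
Qed.

(** Induction on generators in place of the determinant trick. The induction hypothesis gives u with
    u V inside L + Ry; as y is an element of L plus one of J V, some b in J puts (u - b) y into L,
    and (u - b) u works. *)
Lemma nakayama_adjoin J V (s : seq V) (L : set V) : is_ideal J -> submod L ->
  (forall v, foldl (@adjoin V) L s v) -> onto_mod J L ->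
  exists u, J (1 - u) /\ forall v, L (u *: v).
Proof.
move=> iJ; elim: s L => [|y s IHs] L sL Ls Lmod.
  exists 1; split; first by rewrite subrr; apply: ideal0.
  by move=> v; rewrite scale1r; apply: Ls.
have [L0 LD LZ] := sL.
have [|//||u [Ju uL]] := IHs (adjoin L y).
- exact: submod_adjoin.
- move=> v; have [z Lz Jz] := Lmod v; exists z => //.
  by exists 0; rewrite scale0r subr0.
have [z Lz Jyz] := Lmod y.
have [b Jb Lb] : exists2 b, J b & L (u *: (y - z) - b *: y).
  (* [imul] serves as an induction principle, with this property as [Q]. *)
  apply: (Jyz (fun x => exists2 b, J b & L (u *: x - b *: y))) => [|v w [b Jb Lb] [c Jc Lc]|c v Jc].
  - by exists 0; [apply: ideal0 | rewrite scaler0 scale0r subr0].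
  - exists (b + c); first exact: idealD.
    by rewrite scalerDr scalerDl opprD addrACA; apply: LD.
  - have [a La] := uL v; exists (c * a); first exact: idealMr.
    by rewrite scalerA mulrC -!scalerA -scalerBr; apply: LZ.
have Luby : L ((u - b) *: y).
  have -> : (u - b) *: y = (u *: (y - z) - b *: y) + u *: z.
    by rewrite scalerBl scalerBr addrAC subrK.
  by apply: LD => //; apply: LZ.
exists ((u - b) * u); split.
  have -> : 1 - (u - b) * u = (1 - u) + u * (1 - u) + b * u by ring.
  by apply: idealD => //; [apply: idealD => //; apply: idealMl | apply: idealMr].
move=> v; have [a La] := uL v; rewrite -scalerA.
have -> : (u - b) *: (u *: v) = (u - b) *: (u *: v - a *: y) + a *: ((u - b) *: y).
  by rewrite [in X in _ = _ + X]scalerA [a * _]mulrC -scalerA -scalerDr subrK.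
by apply: LD; apply: LZ.
Qed.

(** The element u yields surjectivity at every maximal ideal avoiding it, hence on a whole
    neighbourhood of J. *)
Lemma nakayama J V (I : finType) (g : I -> V) (L : set V) : is_maximal J ->
  generates g -> submod L -> onto_mod J L ->
  exists2 u, ~ J u & forall v, L (u *: v).
Proof.
move=> mJ gV sL Lmod; have iJ := max_ideal mJ.
have [|u [Ju uL]] := nakayama_adjoin (s := map g (index_enum I)) iJ sL _ Lmod.
  move=> v; have [c ->] := gV v; apply: (adjoin_sum (c := c)).
  by rewrite subrr; case: sL.
exists u => // Ju'; apply: (max_proper mJ).
by rewrite -[1](subrK u); apply: idealD.
Qed.

Lemma onto_mod_unit J V (L : set V) u : is_maximal J -> ~ J u ->
  (forall v, L (u *: v)) -> onto_mod J L.
Proof.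
move=> mJ Ju uL v; have [w Jw] := max_inv mJ Ju.
exists (u *: (w *: v)); first exact: uL.
by rewrite scalerA mulrC -[X in X - _]scale1r -scalerBl; apply: imulZ.
Qed.

(** The elements u with u V inside L form an ideal; were it proper, it would lie in a maximal J,
    against [nakayama]. *)
Lemma onto_of_onto_mod V (I : finType) (g : I -> V) (L : set V) :
  generates g -> submod L -> (forall J, is_maximal J -> onto_mod J L) ->
  forall v, L v.
Proof.
move=> gV sL Lmod; have [L0 LD LZ] := sL.
pose K : set R := [set u | forall v, L (u *: v)].
suff K1 : K 1 by move=> v; rewrite -[v]scale1r; apply: K1.
apply: contrapT => K1.
have iK : is_ideal K.
  split=> [v|a b Ka Kb v|r a Ka v].
  - by rewrite scale0r.
  - by rewrite scalerDl; apply: LD.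
  - by rewrite -scalerA; apply: LZ.
have [J mJ KJ] := max_exists iK K1.
have [u Ju uL] := nakayama mJ gV sL (Lmod _ mJ).
exact/Ju/KJ.
Qed.

End Nakayama.

(** * Matrices acting on powers of a module, and surjective capacity *)

Section MatrixAction.
Variables (R : comPzRingType) (N : lmodType R).
Implicit Types (J : set R).

Definition mact k s (A : 'M[R]_(k, s)) (z : {ffun 'I_s -> N}) :
  {ffun 'I_k -> N} := [ffun i => \sum_j A i j *: z j].

Lemma mact_comp k l s (A : 'M[R]_(k, l)) (B : 'M[R]_(l, s)) z :
  mact (A *m B) z = mact A (mact B z).
Proof.
apply/ffunP => i; rewrite !ffunE.
under eq_bigr do rewrite !mxE scaler_suml.
rewrite exchange_big; apply: eq_bigr => j _.
by rewrite ffunE scaler_sumr; apply: eq_bigr => m _; rewrite scalerA.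
Qed.

Lemma mact1 s (z : {ffun 'I_s -> N}) : mact 1%:M z = z.
Proof.
apply/ffunP => i; rewrite ffunE (bigD1 i) //= mxE eqxx scale1r.
by rewrite big1 ?addr0 // => j ji; rewrite mxE eq_sym (negPf ji) scale0r.
Qed.

Lemma mactD k s (A : 'M[R]_(k, s)) : {morph mact A : x y / x + y}.
Proof.
move=> x y; apply/ffunP => i; rewrite !ffunE -big_split.
by apply: eq_bigr => j _; rewrite ffunE scalerDr.
Qed.

Lemma mactZ k s (A : 'M[R]_(k, s)) c x : mact A (c *: x) = c *: mact A x.
Proof.
apply/ffunP => i; rewrite !ffunE scaler_sumr.
by apply: eq_bigr => j _; rewrite ffunE !scalerA mulrC.
Qed.

Lemma mact0 k s (A : 'M[R]_(k, s)) : mact A 0 = 0.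
Proof. by rewrite -[X in mact A X](scale0r 0) mactZ scale0r. Qed.

Lemma mactN k s (A : 'M[R]_(k, s)) x : mact A (- x) = - mact A x.
Proof. by rewrite -scaleN1r mactZ scaleN1r. Qed.

Lemma mactB k s (A : 'M[R]_(k, s)) x y : mact A (x - y) = mact A x - mact A y.
Proof. by rewrite mactD mactN. Qed.

Lemma imul_mact J k s (A : 'M[R]_(k, s)) x : imul J x -> imul J (mact A x).
Proof. by apply: imul_map; [apply: mact0 | apply: mactD | apply: mactZ]. Qed.

Definition fsingle s (i : 'I_s) (x : N) : {ffun 'I_s -> N} :=
  [ffun j => if j == i then x else 0].

Lemma fsingleD s (i : 'I_s) : {morph fsingle i : x y / x + y}.
Proof. by move=> x y; apply/ffunP => j; rewrite !ffunE; case: eqP; rewrite ?addr0. Qed.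

Lemma fsingleZ s (i : 'I_s) c x : fsingle i (c *: x) = c *: fsingle i x.
Proof. by apply/ffunP => j; rewrite !ffunE; case: eqP; rewrite ?scaler0. Qed.

Lemma sum_fsingle s (z : {ffun 'I_s -> N}) : z = \sum_i fsingle i (z i).
Proof.
apply/ffunP => j; rewrite sum_ffunE (bigD1 j) //= ffunE eqxx big1 ?addr0 //.
by move=> i ij; rewrite ffunE eq_sym (negPf ij).
Qed.

Lemma imul_ffun J s (z : {ffun 'I_s -> N}) : (forall i, imul J (z i)) -> imul J z.
Proof.
move=> Jz; rewrite [z]sum_fsingle; apply: imul_sum => i.
apply: imul_map (Jz i); [|exact: fsingleD|exact: fsingleZ].
by apply/ffunP => j; rewrite !ffunE; case: eqP.
Qed.

Lemma generates_ffun (I : finType) (g : I -> N) s : generates g ->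
  generates (fun p : 'I_s * I => fsingle p.1 (g p.2)).
Proof.
move=> gN z; pose c i := sval (cid (gN (z i))).
exists (fun p => c p.1 p.2); rewrite [LHS]sum_fsingle.
rewrite -(pair_bigA _ (fun i j => c i j *: fsingle i (g j))) /=.
apply: eq_bigr => i _; rewrite {1}(svalP (cid (gN (z i)))) -/(c i).
rewrite (big_morph (fsingle i) (fsingleD i) (id1 := 0)); last first.
  by apply/ffunP => j; rewrite !ffunE; case: eqP.
by apply: eq_bigr => j _; rewrite fsingleZ.
Qed.

Lemma imul_mact_mod J k s (A B : 'M[R]_(k, s)) z :
  eqmx_mod J A B -> imul J (mact A z - mact B z).
Proof.
move=> AB; apply: imul_ffun => i; rewrite !ffunE -sumrB.
by apply: imul_sum => j; rewrite -scalerBl; apply: imulZ.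
Qed.

Lemma submod_mact k s (A : 'M[R]_(k, s)) L : submod L -> submod (mact A @` L).
Proof.
move=> [L0 LD LZ]; split=> [|_ _ [x Lx <-] [y Ly <-]|c _ [x Lx <-]].
- by exists 0 => //; apply: mact0.
- by exists (x + y); [apply: LD | rewrite mactD].
- by exists (c *: x); [apply: LZ | rewrite mactZ].
Qed.

(** Only the matrix modulo J matters, which is what lets matrices be chosen by the Chinese remainder
    theorem. *)
Lemma onto_mod_congr J k s (A B : 'M[R]_(k, s)) L : eqmx_mod J A B ->
  onto_mod J (mact A @` L) -> onto_mod J (mact B @` L).
Proof.
move=> AB LA v; have [_ [z Lz <-] Jz] := LA v; exists (mact B z); first by exists z.
rewrite -(subrK (mact A z) v) -addrA; apply: imulD => //.
exact: imul_mact_mod.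
Qed.

Lemma onto_mod_mact J k s (A : 'M[R]_(k, s)) (B : 'M[R]_(s, k)) L :
  A *m B = 1%:M -> onto_mod J L -> onto_mod J (mact A @` L).
Proof.
move=> AB LJ v; have [z Lz Jz] := LJ (mact B v); exists (mact A z); first by exists z.
by rewrite -[v]mact1 -AB mact_comp -mactB; apply: imul_mact.
Qed.

Lemma mact_image k l s (A : 'M[R]_(k, l)) (B : 'M[R]_(l, s)) L :
  mact (A *m B) @` L = mact A @` (mact B @` L).
Proof.
by rewrite image_comp; apply: eq_imagel => z _; apply: mact_comp.
Qed.

(* The surjective capacity modulo J of the submodule L of N^s, where only
   R-linear combinations of the coordinates are allowed. *)
Definition cap_ge s (L : set {ffun 'I_s -> N}) J k :=
  exists A : 'M[R]_(k, s), onto_mod J (mact A @` L).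

Lemma cap_ge0 s (L : set {ffun 'I_s -> N}) J : L !=set0 -> cap_ge L J 0.
Proof.
move=> [z Lz]; exists 0 => v; exists (mact 0 z); first by exists z.
by rewrite [_ - _](_ : _ = 0) //; apply/ffunP => -[].
Qed.

Lemma cap_geS s (L : set {ffun 'I_s -> N}) J k : cap_ge L J k.+1 -> cap_ge L J k.
Proof.
(* The truncated identity matrix drops the last row of [A]; its transpose is a right inverse. *)
move=> [A LA]; exists (\matrix_(i, j) (i == j :> nat)%:R *m A).
rewrite mact_image; apply: (onto_mod_mact (B := \matrix_(i, j) (i == j :> nat)%:R)) => //.
apply/matrixP => i j; rewrite !mxE.
rewrite (bigD1 (widen_ord (leqnSn k) i)) //= !mxE /= eqxx mul1r big1 ?addr0 //.
move=> l; rewrite -val_eqE /= => li; rewrite !mxE [nat_of_ord i == _]eq_sym.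
by rewrite (negPf li) mul0r.
Qed.

Lemma cap_ge_le s (L : set {ffun 'I_s -> N}) J k l :
  (k <= l)%N -> cap_ge L J l -> cap_ge L J k.
Proof.
move/subnK <-; elim: (l - k)%N => [//|d IHd]; rewrite addSn => /cap_geS.
exact: IHd.
Qed.

(** The same matrix works at all maximal ideals that avoid the element given by [nakayama]. *)
Lemma cap_ge_open s (L : set {ffun 'I_s -> N}) J k (I : finType) (g : I -> N) :
  generates g -> submod L -> is_maximal J -> cap_ge L J k ->
  exists2 u, ~ J u & forall K, is_maximal K -> ~ K u -> cap_ge L K k.
Proof.
move=> gN sL mJ [A LA].
have [u Ju uL] := nakayama mJ (generates_ffun gN) (submod_mact A sL) LA.
by exists u => // K mK Ku; exists A; apply: onto_mod_unit uL.
Qed.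

End MatrixAction.

(** * Dropping a generator *)

Section Reduction.
Variables (R : comPzRingType) (s : nat).
Implicit Types (J : set R) (a : 'cV[R]_s) (b : 'rV[R]_s).

(* In terms of generators f_0, ..., f_s: replace f_0 by f_0' = f_0 + sum b_i f_i,
   then drop f_0' after adding a_i f_0' to each f_i. *)
Definition red_mx a b : 'M[R]_(s, 1 + s) := row_mx a (1%:M + a *m b).

(** The form f_0'. Stacked over [red_mx] it gives an invertible matrix, with inverse [red_ker]
    beside [red_sec]; so [red_sec] is a right inverse of [red_mx], and [red_ker] spans its
    kernel. *)
Definition red_form a b : 'M[R]_(1, 1 + s) := row_mx 1%:M b.

Definition red_sec b : 'M[R]_(1 + s, s) := col_mx (- b) 1%:M.

Definition red_ker a b : 'M[R]_(1 + s, 1) := col_mx (1%:M + b *m a) (- a).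

Lemma red_split a b :
  red_sec b *m red_mx a b + red_ker a b *m red_form a b = 1%:M.
Proof.
rewrite !mul_col_mx !mul_mx_row add_col_mx !add_row_mx !mulmx1 !mul1mx.
rewrite mulmxDr mulmxDl mulmx1 mul1mx !mulNmx mulmxA scalar_mx_block.
congr (col_mx (row_mx _ _) (row_mx _ _)).
- by rewrite addrC addrK.
- by rewrite -opprD addNr.
- exact: subrr.
- by rewrite addrK.
Qed.

(** Modulo J, a matrix that kills the kernel of [red_mx] factors through [red_mx]. *)
Lemma red_cancel J k (A : 'M[R]_(k, 1 + s)) a b : is_ideal J ->
  eqmx_mod J (A *m red_ker a b) 0 ->
  eqmx_mod J A (A *m red_sec b *m red_mx a b).
Proof.
move=> iJ Aq; rewrite -{1}[A]mulmx1 -(red_split a b) mulmxDr !mulmxA.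
rewrite -[X in eqmx_mod J _ X]addr0 -(mul0mx _ (red_form a b)).
apply: eqmx_modD => //; first exact: eqmx_mod_refl.
by apply: eqmx_modM => //; exact: eqmx_mod_refl.
Qed.

(** With at most s rows, [A] kills some nonzero x modulo J; [a] and [b] are chosen to make [red_ker]
    proportional to x. *)
Lemma red_ker_exists J k (A : 'M[R]_(k, 1 + s)) : is_maximal J -> (k <= s)%N ->
  exists a b, eqmx_mod J (A *m red_ker a b) 0.
Proof.
move=> mJ ks; have iJ := max_ideal mJ.
have [x [[i xi] Ax]] := max_kernel A mJ (ks : (k < 1 + s)%N).
suff [a [b [c qx]]] : exists a b c, eqmx_mod J (red_ker a b) (c *: x).
  exists a, b; apply: (eqmx_mod_trans iJ (eqmx_modM iJ (eqmx_mod_refl A iJ) qx)).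
  rewrite -scalemxAr => l j.
  by have := Ax l j; rewrite !mxE !subr0; apply: idealMl.
(* If the first entry of [x] is a unit modulo J, it is scaled to 1 and [b = 0]. Otherwise a later
   entry is a unit, and [b] makes the first entry 1 + b a of [red_ker] vanish modulo J as well. *)
have [x0|x0] := pselect (J (x (lshift s 0) 0)); last first.
  have [w Jw] := max_inv mJ x0.
  exists (- (w *: dsubmx x)), 0, w => l j; rewrite ord1.
  rewrite mxE [in X in _ - X]mxE mul0mx addr0 opprK; case: splitP => l' lE.
    have -> : l = lshift s 0 by apply: val_inj; rewrite /= lE ord1.
    by rewrite !mxE ord1 eqxx.
  have -> : l = rshift 1 l' by apply: val_inj.
  by rewrite !mxE subrr; apply: ideal0.
have [i' iE] : exists i', i = rshift 1 i'.
  have [i0|i1] := splitP i => iE; last by exists i1; apply: val_inj.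
  case: xi; suff -> : i = lshift s 0 by [].
  by apply: val_inj; rewrite /= iE ord1.
rewrite iE in xi; have [w Jw] := max_inv mJ xi.
exists (- dsubmx x), (w *: delta_mx 0 i'), 1 => l j; rewrite ord1 scale1r.
rewrite mxE opprK; case: splitP => l' lE.
  have -> : l = lshift s 0 by apply: val_inj; rewrite /= lE ord1.
  rewrite mulmxN -scalemxAl -rowE !mxE !ord1 eqxx.
  by apply: idealB.
have -> : l = rshift 1 l' by apply: val_inj.
by rewrite !mxE subrr; apply: ideal0.
Qed.

Variable N : lmodType R.
Implicit Types (L : set {ffun 'I_(1 + s) -> N}).

(** One Gaussian step makes the column [A *m red_ker a b] vanish modulo J, at the price of one
    row. *)
Lemma cap_red J L a b k : is_maximal J ->
  cap_ge L J k.+1 -> cap_ge (mact (red_mx a b) @` L) J k.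
Proof.
move=> mJ [A LA]; have iJ := max_ideal mJ.
have [C [D [CD Cc]]] := max_elim (A *m red_ker a b) mJ.
exists (C *m A *m red_sec b); rewrite -mact_image.
apply: (@onto_mod_congr _ _ _ _ _ (C *m A)).
  by apply: red_cancel => //; rewrite -mulmxA.
by rewrite mact_image; apply: onto_mod_mact CD LA.
Qed.

(** [a] and [b] are fitted to a matrix realizing the largest capacity k <= s; smaller values follow
    by [cap_ge_le]. *)
Lemma cap_red_exists J L : is_maximal J -> L !=set0 ->
  exists a b, forall k, (k <= s)%N ->
    cap_ge L J k -> cap_ge (mact (red_mx a b) @` L) J k.
Proof.
move=> mJ L0; have iJ := max_ideal mJ.
pose P k := `[< cap_ge L J k >] && (k <= s)%N.
have [|k|k /andP[/asboolP[A LA] ks] kmax] := @ex_maxnP P s.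
- by exists 0; rewrite /P leq0n andbT; apply/asboolP/cap_ge0.
- by case/andP.
have [a [b Aq]] := red_ker_exists A mJ ks.
exists a, b => l ls Ll; apply: (@cap_ge_le _ _ _ _ _ _ k).
  by apply: kmax; rewrite /P ls andbT; apply/asboolP.
exists (A *m red_sec b); rewrite -mact_image.
by apply: onto_mod_congr LA; apply: red_cancel.
Qed.

Lemma cap_red_congr J L a b a' b' k : is_maximal J ->
  eqmx_mod J a a' -> eqmx_mod J b b' ->
  cap_ge (mact (red_mx a b) @` L) J k -> cap_ge (mact (red_mx a' b') @` L) J k.
Proof.
move=> mJ aa bb [A LA]; have iJ := max_ideal mJ; exists A; move: LA.
rewrite -!mact_image; apply: onto_mod_congr.
apply: eqmx_modM => //; first exact: eqmx_mod_refl.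
apply: eqmx_mod_row => //; apply: eqmx_modD => //; first exact: eqmx_mod_refl.
exact: eqmx_modM.
Qed.

Lemma cap_red_finite L (X : seq (set R)) : L !=set0 ->
  (forall J, J \in X -> is_maximal J) ->
  exists a b, forall J k, J \in X -> (k <= s)%N ->
    cap_ge L J k -> cap_ge (mact (red_mx a b) @` L) J k.
Proof.
move=> L0 mX.
have /choice[G GP] : forall J : set R, exists ab : 'cV[R]_s * 'rV[R]_s,
    is_maximal J -> forall k, (k <= s)%N ->
    cap_ge L J k -> cap_ge (mact (red_mx ab.1 ab.2) @` L) J k.
  move=> J; have [mJ|nJ] := pselect (is_maximal J); last by exists (0, 0).
  by have [a [b H]] := cap_red_exists mJ L0; exists (a, b).
have [a aG] := chinese_mx (fun J => (G J).1) mX.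
have [b bG] := chinese_mx (fun J => (G J).2) mX.
exists a, b => J k JX ks Lk; have mJ := mX J JX; have iJ := max_ideal mJ.
apply: (@cap_red_congr _ _ (G J).1 (G J).2) => //.
- by apply: eqmx_mod_sym => //; apply: aG.
- by apply: eqmx_mod_sym => //; apply: bG.
- exact: GP.
Qed.

End Reduction.

(* Either A is injective modulo J, or a nonzero row vector kills the image of
   mact A modulo J, and then N = J N. *)
Lemma onto_mod_square (R : comPzRingType) (N : lmodType R) (J : set R) t
    (L : set {ffun 'I_t -> N}) : is_maximal J -> cap_ge L J t -> onto_mod J L.
Proof.
move=> mJ [A LA]; have iJ := max_ideal mJ.
have [[y [[j yj] yA]]|ny] := pselect (exists y : 'rV[R]_t,
    (exists j, ~ J (y 0 j)) /\ eqmx_mod J (y *m A) 0).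
  have [w Jw] := max_inv mJ yj.
  (* As [y] kills the image of [A] modulo J, applying it to n in position j shows that y_j n lies in
     J N, where y_j is a unit modulo J. *)
  have JN (n : N) : imul J n.
    have [_ [z Lz <-] Jz] := LA (fsingle j n).
    have {}Jz := imul_mact y Jz; rewrite mactB -mact_comp in Jz.
    have Jyj : imul J (mact y (fsingle j n)).
      rewrite -[X in imul J X](subrK (mact (y *m A) z)); apply: imulD => //.
      by have := imul_mact_mod z yA; rewrite [mact 0 z](_ : _ = 0) ?subr0 //;
         apply/ffunP => i; rewrite !ffunE big1 // => k _; rewrite mxE scale0r.
    have {}Jyj : imul J (y 0 j *: n).
      have <- : mact y (fsingle j n) 0 = y 0 j *: n.
        rewrite ffunE (bigD1 j) //= ffunE eqxx big1 ?addr0 // => i ij.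
        by rewrite ffunE (negPf ij) scaler0.
      apply: (imul_map (f := fun v : {ffun 'I_1 -> N} => v 0)) Jyj.
      - by rewrite ffunE.
      - by move=> u v; rewrite ffunE.
      - by move=> c u; rewrite ffunE.
    have -> : n = (1 - w * y 0 j) *: n + w *: (y 0 j *: n).
      by rewrite scalerA -scalerDl subrK scale1r.
    by apply: imulD; [apply: imulZ | apply: imul_scale].
  move=> v; have [_ [z Lz _] _] := LA v; exists z => //.
  by apply: imul_ffun => i; apply: JN.
(* The rows of a left inverse of [A] modulo J. The system with columns A^T and e_i has t equations
   and t + 1 unknowns; the last entry [c] of a nonzero solution is a unit, since otherwise the other
   entries would kill [A]. *)
have /choice[B BP] : forall i : 'I_t, exists B : 'rV[R]_t,
    eqmx_mod J (B *m A) (delta_mx 0 i).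
  move=> i; have [x [[l xl] Ax]] := max_kernel (row_mx A^T (delta_mx i 0))
    mJ (ltac:(by rewrite addn1) : (t < t + 1)%N).
  pose c := x (rshift t 0) 0.
  have Jx j : J (((usubmx x)^T *m A) 0 j + c * (i == j)%:R).
    have := Ax j 0; rewrite -[x in row_mx _ _ *m x]vsubmxK mul_row_col.
    rewrite !mxE subr0 big_ord1 !mxE eqxx andbT [c * _]mulrC [i == j]eq_sym.
    by congr (J (_ + _)); apply: eq_bigr => k _; rewrite !mxE mulrC.
  have [Jc|Jc] := pselect (J c).
    case: ny; exists (usubmx x)^T; split.
      have [l' lE|l' lE] := splitP l.
        exists l'; rewrite !mxE; suff <- : l = lshift 1 l' by [].
        exact: val_inj.
      case: xl; suff -> : l = rshift t 0 by [].
      by apply: val_inj; rewrite /= lE ord1.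
    move=> i' j; rewrite ord1 [X in _ - X]mxE subr0 -[X in J X](addrK (c * (i == j)%:R)).
    by apply: idealB => //; apply: idealMr.
  have [w Jw] := max_inv mJ Jc.
  exists (- w *: (usubmx x)^T) => i' j.
  rewrite ord1 -scalemxAl mxE [delta_mx _ _ _ _]mxE eqxx /= [j == i]eq_sym.
  have := Jx j; set y := (_ *m A) 0 j => Jy.
  have -> : - w * y - (i == j)%:R =
    - w * (y + c * (i == j)%:R) - (1 - w * c) * (i == j)%:R by ring.
  by apply: idealB => //; [apply: idealMl | apply: idealMr].
pose A' : 'M[R]_t := \matrix_(i, j) B i 0 j.
have A'A : eqmx_mod J (A' *m A) 1%:M.
  move=> i j; have := BP i 0 j; rewrite !mxE eqxx /= [j == i]eq_sym.
  by congr (J (_ - _)); apply: eq_bigr => k _; rewrite mxE.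
move=> v; have [_ [z Lz <-] Jz] := LA (mact A v); exists z => //.
have {}Jz := imul_mact A' Jz; rewrite -mactB -mact_comp in Jz.
rewrite -[v - z]mact1 -[X in imul J X](subrK (mact (A' *m A) (v - z))).
apply: imulD => //; apply: imul_mact_mod.
exact: eqmx_mod_sym.
Qed.

(** * General position *)

Section Noetherian.
Variable T : topologicalType.
Hypothesis noethT : noetherian_space T.

(** A closed set violating P would contain a strictly smaller one, and so on without end. *)
Lemma noetherian_ind (P : set T -> Prop) :
  (forall C, closed C -> (forall D, closed D -> D `<` C -> P D) -> P C) ->
  forall C, closed C -> P C.
Proof.
move=> Pind C0 cC0; apply: contrapT => nPC0.
pose Bad := {C : set T | closed C /\ ~ P C}.
have /choice[f fP] : forall C : Bad, exists D : Bad, sval D `<` sval C.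
  move=> [C [cC nPC]]; apply: contrapT => /forallNP nD; apply: (nPC).
  apply: Pind => // D cD DC; apply: contrapT => nPD.
  exact: (nD (exist _ D (conj cD nPD))).
pose G n := iter n f (exist _ C0 (conj cC0 nPC0)).
have Gsub n : sval (G n.+1) `<` sval (G n) by apply: fP.
have [||n nP] := noethT (F := fun n => sval (G n)).
- by move=> n; case: (svalP (G n)).
- by move=> n; apply: properW.
- by have := Gsub n; rewrite (nP n.+1 (leqnSn n)) => /properxx.
Qed.

(** Noetherian induction: a reducible C is the union of two proper closed subsets, whose lists are
    concatenated. *)
Lemma irreducible_components (C : set T) : closed C ->
  exists s : seq (set T),
    (forall W, W \in s -> [/\ closed W, irreducible W & W `<=` C]) /\
    forall Z, irreducible Z -> Z `<=` C -> exists2 W, W \in s & Z `<=` W.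
Proof.
move: C; apply: noetherian_ind => C cC IH.
have [C0|/set0P Cn0] := eqVneq C set0.
  exists [::]; split=> [W|Z [[z Zz] _]]; first by rewrite in_nil.
  by rewrite C0 => /(_ z Zz).
have [iC|nC] := pselect (irreducible C).
  exists [:: C]; split=> [W|Z _ ZC]; last by exists C; rewrite ?mem_head.
  by rewrite inE => /eqP->; split.
have [A [B [cA cB CAB nCA nCB]]] : exists A B,
    [/\ closed A, closed B, C `<=` A `|` B, ~ C `<=` A & ~ C `<=` B].
  apply: contrapT => /forallNP nAB; apply: nC; split=> // A B cA cB CAB.
  apply: contrapT => /not_orP[nCA nCB].
  by have /forallNP/(_ B) := nAB A; apply.
have sub D : closed D -> ~ C `<=` D -> closed (C `&` D) /\ C `&` D `<` C.
  move=> cD nCD; split; first exact: closedI.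
  split; first exact: subIsetl.
  by move=> CCD; apply: nCD => x /CCD[].
have [cCA CAC] := sub A cA nCA; have [cCB CBC] := sub B cB nCB.
have [s [sW sZ]] := IH _ cCA CAC; have [r [rW rZ]] := IH _ cCB CBC.
exists (s ++ r); split=> [W|Z iZ ZC].
  rewrite mem_cat => /orP[/sW|/rW] [cW iW WC]; split=> //;
    by apply: subset_trans WC _; apply: subIsetl.
have [_ /(_ A B cA cB)] := iZ; case.
- exact: subset_trans CAB.
- move=> ZA; have [|W Ws ZW] := sZ Z iZ; first by move=> x Zx; split; [apply: ZC|apply: ZA].
  by exists W; rewrite // mem_cat Ws.
- move=> ZB; have [|W Ws ZW] := rZ Z iZ; first by move=> x Zx; split; [apply: ZC|apply: ZB].
  by exists W; rewrite // mem_cat Ws orbT.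
Qed.

End Noetherian.

Section Chains.
Variable T : topologicalType.

(** For closed irreducible Z this means dim Z >= k, as the top of a chain inside Z may be replaced
    by Z. *)
Definition dim_ge (Z : set T) (k : nat) := exists F, irreducible_chain k F /\ F k = Z.

Lemma dim_ge0 Z : closed Z -> irreducible Z -> dim_ge Z 0.
Proof. by move=> cZ iZ; exists (fun=> Z); split=> //; split=> // i. Qed.

Lemma dim_geS Z W k : closed W -> irreducible W -> Z `<` W ->
  dim_ge Z k -> dim_ge W k.+1.
Proof.
move=> cW iW ZW [F [[Fci Flt] FZ]].
exists (fun i => if (i <= k)%N then F i else W); split; last by rewrite ltnn.
split=> i.
  by move=> _; case: ifP => // /Fci.
rewrite ltnS; case: (ltngtP i k) => [ik _|//|-> _]; first exact: Flt.
by rewrite FZ.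
Qed.

Lemma closure1_irreducible (x : T) : irreducible (closure [set x]).
Proof.
split; first by exists x; apply: subset_closure.
move=> A B cA cB xAB.
have [Ax|Bx] := xAB x (subset_closure (erefl : [set x] x)); [left | right].
  by rewrite (closure_id A).1 //; apply: closure_subset => _ ->.
by rewrite (closure_id B).1 //; apply: closure_subset => _ ->.
Qed.

End Chains.

(** * The Eisenbud-Evans reduction *)

Section GeneralPosition.
Variables (R : comPzRingType) (N : lmodType R) (I : finType) (g : I -> N).
Hypothesis gN : generates g.
Variables (T : topologicalType) (pt : T -> set R).
Hypothesis noethT : noetherian_space T.
Hypothesis max_pt : forall x, is_maximal (pt x).
Hypothesis open_pt : forall u, open [set x | ~ pt x u].

Lemma open_cap s (L : set {ffun 'I_s -> N}) k : submod L ->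
  open [set x | cap_ge L (pt x) k].
Proof.
move=> sL; rewrite openE => x /= Lx.
have [u xu uL] := cap_ge_open gN sL (max_pt x) Lx.
rewrite /interior; apply: (@filterS _ _ _ [set x | ~ pt x u]).
  by move=> y /= yu; apply: uL.
exact: open_nbhs_nbhs.
Qed.

Variable t : nat.

(* The dimension condition of Eisenbud-Evans: the generic capacity on Z is at
   least t + dim Z, unless it is already everything. *)
Definition generic s (L : set {ffun 'I_s -> N}) := forall Z k,
  closed Z -> irreducible Z -> dim_ge Z k ->
  exists2 x : T, Z x & cap_ge L (pt x) (minn s (t + k)).

(** Let Y be the closed set where capacity k + 1 fails. If Z lies in Y, it lies in a component W of
    Y, and Z = W because strictly larger sets leave Y by hypothesis. So one point of capacity k on
    each component that has one is enough. *)
Lemma test_points s (L : set {ffun 'I_s -> N}) k : submod L ->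
  exists X : seq T, forall Z, closed Z -> irreducible Z ->
    (forall W, closed W -> irreducible W -> Z `<` W ->
      exists2 x, W x & cap_ge L (pt x) k.+1) ->
    (exists2 x, Z x & cap_ge L (pt x) k) ->
    exists2 x, Z x & cap_ge L (pt x) k.+1 \/ x \in X /\ cap_ge L (pt x) k.
Proof.
move=> sL; pose Y := ~` [set x | cap_ge L (pt x) k.+1].
have cY : closed Y by apply/open_closedC/open_cap.
have [r [rW rZ]] := irreducible_components noethT cY.
have /choice[h hP] : forall W : set T, exists l : seq T,
    (exists2 x, W x & cap_ge L (pt x) k) ->
    exists2 x, W x & x \in l /\ cap_ge L (pt x) k.
  move=> W; have [[x Wx Lx]|nW] := pselect (exists2 x, W x & cap_ge L (pt x) k).
    by exists [:: x] => _; exists x; rewrite // mem_head.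
  by exists [::].
exists (flatten [seq h W | W <- r]) => Z cZ iZ ZW Zk.
have [ZY|] := pselect (Z `<=` Y); last first.
  move=> /existsNP[x /not_implyP[Zx /contrapT Lx]].
  by exists x => //; left.
have [W Wr ZsubW] := rZ Z iZ ZY; have [cW iW WY] := rW W Wr.
have [eZW|/eqP nZW] := eqVneq Z W.
  have [x Zx [xh Lx]] := hP Z Zk; exists x => //; right; split=> //.
  by apply/flattenP; exists (h Z) => //; apply: map_f; rewrite eZW.
have [|x /WY nLx Lx] := ZW W cW iW; last by case: nLx.
by rewrite properEneq; split=> //; apply/eqP.
Qed.

Lemma generic_red s (L : set {ffun 'I_(1 + s) -> N}) : submod L -> (t <= s)%N ->
  generic L -> exists a b, generic (mact (red_mx a b) @` L).
Proof.
move=> sL ts Lgen.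
have /choice[X XP] := fun k => test_points (t + k) sL.
(* Test points are needed only when [t + k <= s], so the levels [k <= s] suffice. *)
pose J := [seq pt x | x <- flatten [seq X k | k <- iota 0 s.+1]].
have [||a [b abP]] := @cap_red_finite _ _ _ L J.
- by exists 0; case: sL.
- by move=> _ /mapP[x _ ->].
exists a, b => Z k cZ iZ Zk.
(* If [s < t + k], the old bound is s + 1 and the new one s, so losing one copy is harmless. *)
have [sk|ks] := ltnP s (t + k).
  have [x Zx] := Lgen Z k cZ iZ Zk; rewrite (minn_idPl sk) => Lx.
  by exists x => //; apply: cap_red.
(* A strictly larger W has dimension at least k + 1, hence old bound t + k + 1, as [test_points]
   requires. *)
have [||x Zx [Lx|[xX Lx]]] := XP k Z cZ iZ.
- move=> W cW iW ZW; have [x Wx] := Lgen W k.+1 cW iW (dim_geS cW iW ZW Zk).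
  by rewrite addnS (minn_idPr _) //; exists x.
- have [x Zx] := Lgen Z k cZ iZ Zk.
  by rewrite (minn_idPr (leqW ks)); exists x.
- by exists x => //; apply: cap_red.
exists x => //; apply: abP => //; apply: map_f; apply/flattenP; exists (X k) => //.
by apply: map_f; rewrite mem_iota ltnS (leq_trans (leq_addl t k)).
Qed.

Theorem generic_position j s (L : set {ffun 'I_s -> N}) :
  s = (t + j)%N -> submod L -> generic L ->
  exists A : 'M[R]_(t, s), forall x, onto_mod (pt x) (mact A @` L).
Proof.
elim: j s L => [|j IHj] s L; rewrite ?addn0 ?addnS => eqs.
  rewrite eqs in L * => sL Lgen; exists 1%:M => x.
  have -> : mact 1%:M @` L = L by apply: eq_image_id => z _; apply: mact1.
  have ix := closure1_irreducible x; have cx : closed (closure [set x]).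
    exact: closed_closure.
  (* [y] lies in the closure of [x], so the open locus of capacity t contains [x] along with [y]. *)
  have [y xy] := Lgen _ 0 cx ix (dim_ge0 cx ix).
  rewrite addn0 minnn => Ly.
  have [] := xy [set z | cap_ge L (pt z) t]; last first.
    by move=> _ [->]; apply: onto_mod_square.
  by apply: open_nbhs_nbhs; split=> //; apply: open_cap.
rewrite eqs in L * => sL Lgen.
have [a [b /IHj]] := generic_red sL (leq_addr j t) Lgen.
case=> // [|A AL]; first exact: submod_mact.
by exists (A *m red_mx a b) => x; rewrite mact_image.
Qed.

End GeneralPosition.

(** * Patching finitely many local families *)

Section Patching.
Variables (R : comPzRingType) (N : lmodType R) (I : finType) (g : I -> N).
Hypothesis gN : generates g.
Variables (T : topologicalType) (pt : T -> set R).
Hypothesis noethT : noetherian_space T.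
Hypothesis max_pt : forall x, is_maximal (pt x).
Hypothesis open_pt : forall u, open [set x | ~ pt x u].
Variables (M : lmodType R) (H : set (M -> N)).
Hypothesis H0 : H (fun=> 0).
Hypothesis HD : forall f x y, H f -> f (x + y) = f x + f y.
Hypothesis HZ : forall f c x, H f -> f (c *: x) = c *: f x.

Definition fam_image s (F : 'I_s -> M -> N) : set {ffun 'I_s -> N} :=
  range (fun x => [ffun i => F i x]).

Lemma submod_fam_image s (F : 'I_s -> M -> N) :
  (forall i, H (F i)) -> submod (fam_image F).
Proof.
move=> HF; split=> [|_ _ [x _ <-] [y _ <-]|c _ [x _ <-]].
- by exists 0 => //; apply/ffunP => i; rewrite !ffunE -[X in F i X](scale0r 0) HZ // scale0r.
- by exists (x + y) => //; apply/ffunP => i; rewrite !ffunE HD.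
- by exists (c *: x) => //; apply/ffunP => i; rewrite !ffunE HZ.
Qed.

Definition fam_cat s r (F : 'I_s -> M -> N) (F' : 'I_r -> M -> N) (i : 'I_(s + r)) :=
  match fintype.split i with inl j => F j | inr j => F' j end.

Lemma fam_cat_image s r k (F : 'I_s -> M -> N) (F' : 'I_r -> M -> N)
    (A : 'M[R]_(k, s)) (B : 'M[R]_(k, r)) x :
  mact (row_mx A B) [ffun i => fam_cat F F' i x] =
  mact A [ffun i => F i x] + mact B [ffun i => F' i x].
Proof.
apply/ffunP => i; rewrite !ffunE big_split_ord.
congr (_ + _); apply: eq_bigr => j _; rewrite !ffunE /fam_cat.
  by rewrite (unsplitK (inl j)) row_mxEl.
by rewrite (unsplitK (inr j)) row_mxEr.
Qed.

Lemma cap_catl s r (F : 'I_s -> M -> N) (F' : 'I_r -> M -> N) J k :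
  cap_ge (fam_image F) J k -> cap_ge (fam_image (fam_cat F F')) J k.
Proof.
move=> [A LA]; exists (row_mx A 0) => v; have [_ [_ [x _ <-] <-] Jv] := LA v.
exists (mact A [ffun i => F i x]) => //; exists [ffun i => fam_cat F F' i x].
  by exists x.
rewrite fam_cat_image -[RHS]addr0; congr (_ + _); apply/ffunP => i.
by rewrite !ffunE big1 // => j _; rewrite mxE scale0r.
Qed.

Lemma cap_catr s r (F : 'I_s -> M -> N) (F' : 'I_r -> M -> N) J k :
  cap_ge (fam_image F') J k -> cap_ge (fam_image (fam_cat F F')) J k.
Proof.
move=> [A LA]; exists (row_mx 0 A) => v; have [_ [_ [x _ <-] <-] Jv] := LA v.
exists (mact A [ffun i => F' i x]) => //; exists [ffun i => fam_cat F F' i x].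
  by exists x.
rewrite fam_cat_image -[RHS]add0r; congr (_ + _); apply/ffunP => i.
by rewrite !ffunE big1 // => j _; rewrite mxE scale0r.
Qed.

(** Noetherian induction on a closed set C outside which capacity n is reached: appending a family
    that is onto at some x in C shrinks C. *)
Lemma patching t n :
  (forall x, exists F : 'I_n -> M -> N, (forall i, H (F i)) /\ onto_mod (pt x) (fam_image F)) ->
  exists s (F : 'I_s -> M -> N), [/\ (t <= s)%N, forall i, H (F i) &
    forall x, cap_ge (fam_image F) (pt x) n].
Proof.
move=> loc.
pose P (C : set T) := exists s (F : 'I_s -> M -> N), [/\ (t <= s)%N,
  forall i, H (F i) & forall x, ~ C x -> cap_ge (fam_image F) (pt x) n].
suff [s [F [ts HF FP]]] : P set0.
  by exists s, F; split=> // x; apply: FP.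
suff PC C : closed C -> P C -> P set0.
  (* Starting from t zero maps ensures [t <= s]. *)
  by apply: (PC setT closedT); exists t, (fun _ _ => 0); split=> // x [].
move: C; apply: noetherian_ind => // C cC IH [s [F [ts HF FP]]].
have [C0|/set0P[x Cx]] := eqVneq C set0.
  by exists s, F; split=> // x _; apply: FP; rewrite C0.
have [f [Hf xf]] := loc x.
pose D := C `&` ~` [set y | cap_ge (fam_image f) (pt y) n].
have sf := submod_fam_image Hf.
apply: (IH D).
- by apply: closedI => //; apply/open_closedC/(open_cap gN).
- split; first exact: subIsetl.
  move=> /(_ x Cx)[_]; apply; exists 1%:M.
  by rewrite (_ : mact 1%:M @` _ = fam_image f) //; apply: eq_image_id => z _; apply: mact1.
exists (s + n)%N, (fam_cat F f); split.
- exact: leq_trans (leq_addr _ _).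
- by move=> i; rewrite /fam_cat; case: fintype.split.
move=> y /not_andP[/FP Fy|/contrapT fy]; [exact: cap_catl | exact: cap_catr].
Qed.

(** Capacity n at all points gives [generic], because t + k <= t + d <= n for every chain length
    k. *)
Theorem patched_surjection t d n : (t + d <= n)%N ->
  (forall k (F : nat -> set T), irreducible_chain k F -> (k <= d)%N) ->
  (forall x, exists F : 'I_n -> M -> N, (forall i, H (F i)) /\ onto_mod (pt x) (fam_image F)) ->
  exists s (F : 'I_s -> M -> N) (A : 'M[R]_(t, s)), (forall i, H (F i)) /\ forall x, onto_mod (pt x) (mact A @` fam_image F).
Proof.
move=> tdn dimT /(patching t)[s [F [ts HF FP]]].
have sF := submod_fam_image HF.
have [|A AF] := generic_position gN noethT max_pt open_pt (L := fam_image F)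
    (esym (subnKC ts)) sF.
  move=> Z k cZ iZ [G [Gk _]].
  have [[x Zx] _] := iZ; exists x => //; apply: cap_ge_le (FP x).
  by rewrite geq_min; apply/orP; right; apply: leq_trans tdn; rewrite leq_add2l (dimT k G).
by exists s, F, A.
Qed.

End Patching.

(** * Lifting local homomorphisms *)

Lemma linear_of_fun (A : pzRingType) (U V : lmodType A) (f : U -> V) :
  (forall a x y, f (a *: x + y) = a *: f x + f y) ->
  exists h : {linear U -> V}, h =1 f.
Proof.
move=> flin.
pose h : {linear U -> V} := HB.pack f (GRing.isLinear.Build A U V *:%R f flin).
by exists h.
Qed.

Lemma onto_mod_generates (R : comPzRingType) (V : lmodType R) (I : finType)
    (g : I -> V) (J : set R) (L : set V) : generates g -> submod L ->
  (forall i, exists2 z, L z & imul J (g i - z)) -> onto_mod J L.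
Proof.
move=> gV [L0 LD LZ] Lg v; have [c ->] := gV v.
elim/big_ind: _ => [|x y [z Lz Jz] [t Lt Jt]|i _].
- by exists 0 => //; rewrite subr0; apply: imul0.
- by exists (z + t); [apply: LD | rewrite opprD addrACA; apply: imulD].
- have [z Lz Jz] := Lg i; exists (c i *: z); first exact: LZ.
  by rewrite -scalerBr; apply: imul_scale.
Qed.

Section Fractions.
Variables (R : comPzRingType) (p : Spec R).

Lemma denomMC (u v : denom p) : denomM u v = denomM v u.
Proof.
have ext (x y : denom p) : dval x = dval y -> x = y.
  case: x y => x px [y py] /= xy; case: _ / xy py => py.
  by rewrite (Prop_irrelevance px py).
by apply: ext; apply: mulrC.
Qed.

Lemma common_denom n (Q : 'I_n -> denom p -> Prop) :
  (forall i, exists u, Q i u) -> (forall i u c, Q i u -> Q i (denomM c u)) ->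
  exists u, forall i, Q i u.
Proof.
move=> Qex QM; have /choice[u uQ] := Qex.
suff H (s : seq 'I_n) : exists w, forall i, i \in s -> Q i w.
  have [w wQ] := H (enum 'I_n); exists w => i.
  by apply: wQ; rewrite mem_enum.
elim: s => [|j s [w wQ]]; first by exists (denom1 p).
exists (denomM w (u j)) => i; rewrite inE => /orP[/eqP->|/wQ wi].
  exact/QM/uQ.
suff -> : denomM w (u j) = denomM (u j) w by apply: QM.
exact: denomMC.
Qed.

Lemma lfrac0 (V : lmodType R) u : lfrac (0 : V) u = 0 :> loc p V.
Proof. by apply/frac_eqP; exists (denom1 p); rewrite !scaler0. Qed.

End Fractions.

Section LocalMaps.
Variables (R : comPzRingType) (S : pzRingType) (phi : algebra_map R S) (p : Spec R).
Variable N : lmodType S^c.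
Local Notation N_R := (res_mod phi N).

(** S-linearity of a map into a module over the localized ring, on which s acts as s/1. *)
Definition semilinear (U : lmodType S^c) (G : U -> loc_mod phi p N) :=
  (forall x y, G (x + y) = G x + G y) /\
  (forall (s : S^c) x, G (s *: x) =
     (lfrac (s : alg_mod phi) (denom1 p) : (loc_ring phi p)^c) *: G x).

Lemma semilinear0 (U : lmodType S^c) (G : U -> loc_mod phi p N) :
  semilinear G -> G 0 = 0.
Proof. by move=> [GD _]; apply: (addrI (G 0)); rewrite -GD !addr0. Qed.

Lemma phi_scalerC (V : lmodType S^c) (r : R) (s : S^c) (v : V) :
  (phi r : S^c) *: (s *: v) = s *: ((phi r : S^c) *: v).
Proof. by rewrite !scalerA; congr (_ *: _); exact: (esym (amap_central phi r s)). Qed.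

Lemma lfrac_scale (s : S^c) (w : denom p) (v : N) (u : denom p) :
  (lfrac (s : alg_mod phi) w : (loc_ring phi p)^c) *:
    (lfrac (v : N_R) u : loc_mod phi p N) = lfrac (s *: v : N_R) (denomM w u).
Proof. exact: loc_scaleE. Qed.

Lemma lfrac_act (s : S^c) (v : N) (u : denom p) :
  (lfrac (s : alg_mod phi) (denom1 p) : (loc_ring phi p)^c) *:
    (lfrac (v : N_R) u : loc_mod phi p N) = lfrac (s *: v : N_R) u.
Proof.
rewrite lfrac_scale; apply/frac_eqP; exists (denom1 p).
by rewrite /= mul1r.
Qed.

Lemma lfrac_clear (v : N) (u : denom p) :
  (lfrac (phi (dval u) : alg_mod phi) (denom1 p) : (loc_ring phi p)^c) *:
    (lfrac (v : N_R) u : loc_mod phi p N) = lfrac (v : N_R) (denom1 p).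
Proof.
rewrite lfrac_act; apply/frac_eqP; exists (denom1 p).
by rewrite /= !scale1r.
Qed.

(** The images of the generators get a common denominator [u]. The finitely many relations then go
    to numerators killed by one further denominator [w], so [w] times the map on the free module
    descends to P. *)
Lemma semilinear_lift (P : lmodType S^c) (G : P -> loc_mod phi p N) :
  finitely_presented P -> semilinear G ->
  exists u (h : {linear P -> N}), forall x, lfrac (h x : N_R) u = G x.
Proof.
move=> [n [k [f [q [fsurj qf]]]]] sG; have [GD GZ] := sG; have G0 := semilinear0 sG.
have [|i u c [v vE]|u uP] := @common_denom _ p n
    (fun i u => exists v : N_R, G (f (delta_mx 0 i)) = lfrac v u).
- by move=> i; exists (lden (G (f (delta_mx 0 i)))), (lnum (G (f (delta_mx 0 i))));
    rewrite fracK.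
- by exists (dval c *: v); rewrite frac_scale.
have /choice[v vE] := uP.
pose h0 (x : 'rV[S^c]_n) : N := \sum_i x 0 i *: (v i : N).
have h0lin a x y : h0 (a *: x + y) = a *: h0 x + h0 y.
  rewrite /h0 scaler_sumr -big_split; apply: eq_bigr => i _ /=.
  by rewrite !mxE scalerDl scalerA.
have h0G x : lfrac (h0 x : N_R) u = G (f x).
  rewrite [in RHS](row_sum_delta x) linear_sum /= /h0.
  elim/big_rec2: _ => [|i y z _ IH]; first by rewrite lfrac0 G0.
  by rewrite GD linearZ GZ vE -IH lfrac_act addf_same.
have [|j w c /= wE|w wE] := @common_denom _ p k
    (fun j w => dval w *: (h0 (q (delta_mx 0 j)) : N_R) = 0).
- move=> j; have : G (f (q (delta_mx 0 j))) = 0.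
    have : range q (q (delta_mx 0 j)) by exists (delta_mx 0 j).
    by rewrite qf /= => ->.
  rewrite -h0G => /frac_eqP[w]; rewrite scaler0 scaler0 /= scale1r => E.
  by exists w.
- by rewrite -scalerA wE scaler0.
pose h1 (x : 'rV[S^c]_n) : N := (phi (dval w) : S^c) *: h0 x.
have h1lin a x y : h1 (a *: x + y) = a *: h1 x + h1 y.
  by rewrite /h1 h0lin scalerDr phi_scalerC.
have [h1l h1E] := linear_of_fun h1lin.
have h1q y : h1 (q y) = 0.
  rewrite -h1E (row_sum_delta y) linear_sum linear_sum big1 // => j _.
  by rewrite !linearZ /= h1E /h1 -[X in _ *: X]/(dval w *: (_ : N_R)) wE scaler0.
have h1f x y : f x = f y -> h1 x = h1 y.
  move=> fxy; apply/eqP; rewrite -subr_eq0 -!h1E -linearB /= h1E.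
  have : range q (x - y) by rewrite qf /= linearB /= fxy subrr.
  by move=> [z _ <-]; rewrite h1q.
(* [r] is only a set-theoretic section; linearity comes from [h1] being constant on the fibres of
   [f]. *)
have /choice[r rK] := fsurj.
have hlin a x y : h1 (r (a *: x + y)) = a *: h1 (r x) + h1 (r y).
  by rewrite -h1lin; apply: h1f; rewrite linearP !rK.
have [h hE] := linear_of_fun hlin.
exists (denomM w u), h => x.
by rewrite hE /h1 -[_ *: h0 _]/(dval w *: (_ : N_R)) frac_scale h0G rK.
Qed.

End LocalMaps.

(** * Maps out of direct sums *)

Section DirectSumMaps.
Variables (A : pzRingType) (I : choiceType) (P : I -> lmodType A).

Lemma dsumE a (f g : dsum P) i : (a *: f + g) i = a *: f i + g i. Proof. by []. Qed.

Definition single_fun i (x : P i) (j : I) : P j :=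
  if i =P j is ReflectT e then ecast k (P k) e x else 0.

Lemma single_fun_supp i (x : P i) : fin_supp (single_fun x).
Proof.
apply: (sub_finite_set _ (finite_set1 i)) => j /=.
by rewrite /single_fun; case: eqP => [e|_]; [move=> _; rewrite e | rewrite eqxx].
Qed.

Definition single i (x : P i) : dsum P := DSum (single_fun_supp x).

Lemma single_diag i (x : P i) : single x i = x.
Proof.
rewrite /= /single_fun; case: eqP => // e.
by rewrite (Prop_irrelevance e erefl).
Qed.

Lemma single_off i j (x : P i) : i <> j -> single x j = 0.
Proof. by rewrite /= /single_fun; case: eqP. Qed.

Lemma singleP i a (x y : P i) : single (a *: x + y) = a *: single x + single y.
Proof.
apply: dsum_ext => j; rewrite dsumE /= /single_fun.
case: eqP => [e|_]; last by rewrite scaler0 addr0.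
by case: _ / e.
Qed.

Definition supported (s : seq I) (d : dsum P) := forall i, i \notin s -> d i = 0.

Lemma dsum_supported (d : dsum P) : exists s, supported s d.
Proof.
have /finite_seqP[s sE] := dsum_supp d; exists s => i.
apply: contraNeq => di; have : [set i | d i != 0] i by [].
by rewrite sE.
Qed.

End DirectSumMaps.

Section LiftSum.
Variables (R : comPzRingType) (S : pzRingType) (phi : algebra_map R S) (p : Spec R).
Variable N : lmodType S^c.
Local Notation N_R := (res_mod phi N).
Variables (I : choiceType) (P : I -> lmodType S^c).
Hypothesis fpP : forall i, finitely_presented (P i).

(** Infinitely many summands may have no common denominator, so the lift is claimed only on a finite
    support. Each step splits off the summand j and cross-multiplies the denominators. *)
Lemma semilinear_lift_sum (G : dsum P -> loc_mod phi p N) (s : seq I) :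
  semilinear G -> exists u (h : {linear dsum P -> N}),
    forall d, supported s d -> lfrac (h d : N_R) u = G d.
Proof.
move=> sG; have [GD GZ] := sG.
elim: s => [|j s [u [h hE]]].
  have [|h hE] := @linear_of_fun _ (dsum P) N (fun=> 0).
    by move=> *; rewrite scaler0 addr0.
  exists (denom1 p), h => d d0; rewrite hE lfrac0.
  have -> : d = 0 by apply: dsum_ext => i; apply: d0.
  by rewrite (semilinear0 sG).
have [|v [l lE]] := @semilinear_lift _ _ phi p N (P j) (G \o @single _ _ P j) (fpP j).
  split=> [x y|a x] /=; first by rewrite -GD -[x + y]scale1r -[x in RHS]scale1r;
    rewrite scalerDr singleP !scale1r.
  rewrite -GZ -[a *: x]addr0 singleP; congr G.
  rewrite -[RHS]addr0; congr (_ + _).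
  by apply: dsum_ext => i; rewrite /= /single_fun; case: eqP => // e; case: _ / e.
pose f (d : dsum P) := (phi (dval v) : S^c) *: h (d - single (d j)) +
  (phi (dval u) : S^c) *: l (d j).
have [|k kE] := @linear_of_fun _ _ _ f.
  move=> a x y; rewrite /f.
  have -> : a *: x + y - single ((a *: x + y) j) =
      a *: (x - single (x j)) + (y - single (y j)).
    by rewrite dsumE singleP scalerBr opprD addrACA.
  rewrite linearP dsumE linearP !scalerDr !phi_scalerC.
  by rewrite addrACA.
exists (denomM u v), k => d dj; rewrite kE /f -(@addfE _ _ N_R) lE /= hE.
  by rewrite -GD subrK.
move=> i si; rewrite -[LHS]/(d i - single (d j) i).
have [<-|/eqP ji] := eqVneq j i; first by rewrite single_diag subrr.
rewrite single_off // subr0; apply: dj; rewrite inE negb_or si andbT.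
by apply/eqP => /esym.
Qed.

End LiftSum.

(** * Surjections of localizations and families of homomorphisms *)

Section LocalFamilies.
Variables (R : comPzRingType) (S : pzRingType) (phi : algebra_map R S) (p : Spec R).
Variables M N : lmodType S^c.
Local Notation M_R := (res_mod phi M).
Local Notation N_R := (res_mod phi N).

Definition restricted_hom : set (M_R -> N_R) :=
  [set f : M -> N | exists h : {linear M -> N}, f = h :> (M -> N)].

(** Finitely many elements generate N^n over R, and their preimages under G, cleared of
    denominators, involve finitely many summands; there the components of G lift. Modulo p the
    denominators become invertible. *)
Lemma local_family (I : choiceType) (P : I -> lmodType S^c) (J : finType)
    (g : J -> N_R) n (G : {linear loc_mod phi p M -> {ffun 'I_n -> loc_mod phi p N}}) :
  is_maximal p -> generates g ->
  (forall i, finitely_presented (P i)) -> direct_summand M (dsum P) ->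
  surjection G ->
  exists F : 'I_n -> M_R -> N_R, (forall i, restricted_hom (F i)) /\
    onto_mod p (fam_image F).
Proof.
move=> mp gN fpP [K [e [e' eK e'K]]] Gsurj.
pose inc (m : M) : dsum P := e (m, 0).
pose pr (d : dsum P) : M := (e' d).1.
have incK m : pr (inc m) = m by rewrite /pr /inc eK.
have incP a x y : inc (a *: x + y) = a *: inc x + inc y.
  rewrite /inc -linearP; congr (e _).
  by congr pair; rewrite /= scaler0 addr0.
have e'P a x y : e' (a *: x + y) = a *: e' x + e' y.
  by apply: (can_inj eK); rewrite linearP !e'K.
pose G' a (m : M) : loc_mod phi p N := G (lfrac (m : M_R) (denom1 p)) a.
have sG' a : semilinear (G' a).
  split=> [x y|s x]; rewrite /G'.
    by rewrite -(@addf_same _ _ M_R) linearD ffunE.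
  by rewrite -lfrac_act linearZ ffunE.
have sG a : semilinear (G' a \o pr).
  have [GD GZ] := sG' a; split=> [x y|s x] /=; rewrite -?GD -?GZ; congr (G' a _).
    by have := e'P 1 x y; rewrite !scale1r /pr => ->.
  have := e'P s x 0; have -> : e' 0 = 0.
    by have := e'P 1 0 0; rewrite !scale1r addr0 => /(congr1 (fun z => z - e' 0)); rewrite subrr addrK.
  by rewrite !addr0 /pr => ->.
pose V := {ffun 'I_n -> N_R}.
pose gV (q : 'I_n * J) : V := fsingle q.1 (g q.2).
have gVgen : generates gV by apply: generates_ffun.
have /choice[x xP] : forall q, exists xu : M * denom p, forall a,
    G' a xu.1 = lfrac (dval xu.2 *: gV q a) (denom1 p).
  move=> q; have [xi xiE] := Gsurj [ffun a => lfrac (gV q a) (denom1 p)].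
  exists (lnum xi, lden xi) => a /=; rewrite /G'.
  have := @lfrac_clear _ _ phi p M (lnum xi) (lden xi); rewrite fracK => <-.
  by rewrite linearZ xiE !ffunE lfrac_act.
have [s sP] : exists s, forall q, supported s (inc (x q).1).
  have /choice[r rP] := fun q => dsum_supported (inc (x q).1).
  exists (flatten [seq r q | q <- enum {: 'I_n * J}]) => q i si; apply: rP.
  apply: contraNN si => ri; apply/flattenP; exists (r q) => //.
  by apply: map_f; rewrite mem_enum.
have [a|a u c [h hE]|u uP] := @common_denom _ p n (fun a u => exists h : {linear M -> N},
    forall q, lfrac (h (x q).1 : N_R) u = G' a (x q).1).
- have [u [h hE]] := semilinear_lift_sum fpP s (sG a).
  have [|k kE] := @linear_of_fun _ _ _ (h \o inc).
    by move=> b y z /=; rewrite incP linearP.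
  exists u, k => q; rewrite kE /= hE; last exact: sP.
  by rewrite /= incK.
- have [|k kE] := @linear_of_fun _ _ _ (fun m => (phi (dval c) : S^c) *: h m).
    by move=> b y z; rewrite linearP scalerDr phi_scalerC.
  by exists k => q; rewrite kE -hE; apply: (@frac_scale _ _ N_R).
have {uP} /choice[h hP] := uP.
exists (fun a => h a); split=> [a|]; first by exists (h a).
apply: (onto_mod_generates gVgen).
  apply: (@submod_fam_image _ N_R M_R restricted_hom).
  - by move=> f y z [l ->]; apply: linearD.
  - by move=> f c y [l ->]; apply: (linearZ_LR l (phi c : S^c) y).
  - by move=> a; exists (h a).
move=> q; have iJ := max_ideal mp.
have pu : ~ spec_set p (dval (x q).2 * dval u) by apply: denomM_subproof.
(* [w] inverts at once the denominator of the preimage and the common denominator [u] of the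
   lifts. *)
have [w Jw] := max_inv mp pu.
exists (w *: ([ffun a => h a (x q).1] : V)).
  exists (w *: ((x q).1 : M_R)) => //; apply/ffunP => a; rewrite !ffunE.
  exact: (linearZ_LR (h a) (phi w : S^c) (x q).1).
apply: imul_ffun => a.
have := hP a q; rewrite xP => /frac_eqP[v]; rewrite /= scale1r => E.
have [c Jc] := max_inv mp (dvalP (d := v)).
set y : N_R := h a _ in E *; set z : N_R := gV q a in E *.
(* The difference is killed by [v], a unit modulo p, and so lies in p N. *)
have Jyz : imul p (y - (dval u * dval (x q).2) *: z).
  set t := y - _; have vt : dval v *: t = 0 by rewrite scalerBr -scalerA E subrr.
  have -> : t = (1 - c * dval v) *: t by rewrite scalerBl scale1r -scalerA vt scaler0 subr0.
  exact: imulZ.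
suff : imul p (z - w *: y) by rewrite /z !ffunE.
have -> : z - w *: y = (1 - w * (dval (x q).2 * dval u)) *: z -
    w *: (y - (dval u * dval (x q).2) *: z).
  rewrite scalerBr scalerBl scale1r scalerA [dval u * _]mulrC.
  by rewrite opprB addrA subrK.
apply: imulD; first exact: imulZ.
by apply: imulN; apply: imul_scale.
Qed.

(** Off the support each element of N is killed by some element outside p, so N = p N. *)
Lemma onto_mod_off_support n
    (L : set {ffun 'I_n -> N_R}) :
  is_maximal p -> ~ Supp phi N p -> submod L -> onto_mod p L.
Proof.
move=> mp nN [L0 _ _] v; exists 0 => //; rewrite subr0.
apply: imul_ffun => i.
have : lfrac (v i) (denom1 p) = 0 :> loc_mod phi p N.
  by apply: contrapT => /eqP vi; apply: nN; exists (lfrac (v i) (denom1 p)).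
move=> /frac_eqP[w]; rewrite scaler0 scaler0 /= scale1r => wv.
have [c Jc] := max_inv mp (dvalP (d := w)).
have -> : v i = (1 - c * dval w) *: v i.
  by rewrite scalerBl scale1r -scalerA wv scaler0 subr0.
exact: imulZ.
Qed.

(** f acts on numerators; it stays surjective because a tuple of fractions has a common
    denominator. *)
Lemma localize_surjection n (f : {linear M -> {ffun 'I_n -> N}}) :
  surjection f ->
  exists G : {linear loc_mod phi p M -> {ffun 'I_n -> loc_mod phi p N}}, surjection G.
Proof.
move=> fsurj.
pose h (x : loc_mod phi p M) : {ffun 'I_n -> loc_mod phi p N} :=
  [ffun i => lfrac (f (lnum x) i : N_R) (lden x)].
have hE (m : M_R) u : h (lfrac m u) = [ffun i => lfrac (f m i : N_R) u].
  apply/ffunP => i; rewrite !ffunE; apply/frac_eqP.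
  have [w E] := lnum_lden m u; exists w.
  have fZ (r : R) (x : M_R) : (f (r *: x) i : N_R) = r *: (f x i : N_R).
    by rewrite -[r *: x]/((phi r : S^c) *: (x : M)) linearZ /= ffunE.
  by rewrite -!fZ E.
have [|G GE] := @linear_of_fun _ _ _ h.
  move=> s x y; elim/locP: x => x u; elim/locP: y => y v.
  rewrite -(fracK s); move: (lnum s) (lden s) => a w.
  rewrite lfrac_scale addfE !hE.
  apply/ffunP => i; rewrite !ffunE.
  rewrite lfrac_scale addfE.
  congr lfrac.
  rewrite -[X in f X]/((phi _ : S^c) *: _ + (phi _ : S^c) *: _).
  by rewrite linearD !linearZ !ffunE.
exists G => y.
have [|i u c [v vE]|u uP] := @common_denom _ p n
    (fun i u => exists v : N_R, y i = lfrac v u).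
- by move=> i; exists (lden (y i)), (lnum (y i)); rewrite fracK.
- by exists (dval c *: v); rewrite frac_scale.
have /choice[v vE] := uP.
have [x xE] := fsurj [ffun i => v i : N]; exists (lfrac (x : M_R) u).
by rewrite GE hE; apply/ffunP => i; rewrite ffunE xE ffunE vE.
Qed.

End LocalFamilies.

(** * Suprema and the conclusion *)

Lemma generates_res (R : comPzRingType) (S : pzRingType) (phi : algebra_map R S)
    (N : lmodType S^c) : module_finite phi -> finitely_generated N ->
  exists (J : finType) (g : J -> res_mod phi N), generates g.
Proof.
move=> [k [s ssurj]] [n [f fsurj]].
exists ('I_n * 'I_k)%type.
exists (fun q => (s (delta_mx 0 q.2) : S^c) *: f (delta_mx 0 q.1)) => v.
have [x <-] := fsurj v; have /choice[r rE] := fun i => ssurj (x 0 i).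
exists (fun q => r q.1 0 q.2).
rewrite -(pair_bigA _ (fun i j => r i 0 j *:
  ((s (delta_mx 0 j) : S^c) *: f (delta_mx 0 i) : res_mod phi N))) /=.
rewrite {1}(row_sum_delta x) linear_sum; apply: eq_bigr => i _.
rewrite linearZ /= -(rE i) {1}(row_sum_delta (r i)) linear_sum.
rewrite (@scaler_suml S^c N); apply: eq_bigr => j _.
rewrite linearZ /=.
rewrite -[LHS]/(((phi (r i 0 j) * (s (delta_mx 0 j) : S) : S) : S^c) *: f (delta_mx 0 i)).
by rewrite amap_central -[RHS]/((phi (r i 0 j) : S^c) *: (_ *: _)) scalerA.
Qed.

Section NatSupremum.
Local Open Scope ereal_scope.

(** Both [sur] and [krull_dim] unfold to this. *)
Definition nat_sup (Q : set nat) : \bar int :=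
  supremum -oo [set t%:Z%:E | t in Q].

Lemma nat_supP (Q : set nat) : Q !=set0 ->
  (exists d, [/\ Q d, forall k, Q k -> (k <= d)%N & nat_sup Q = d%:Z%:E]) \/
  ((forall n, exists2 k, Q k & (n <= k)%N) /\ nat_sup Q = +oo).
Proof.
move=> [k0 Qk0].
have E x : supremums [set t%:Z%:E | t in Q] x -> nat_sup Q = x.
  move=> sx; rewrite /nat_sup /supremum ifF.
    by apply: xget_subset1 => //; apply: is_subset1_supremums.
  apply/negbTE/set0P; exists k0%:Z%:E; by exists k0.
have [[n nub]|nobound] := pselect (exists n, forall k, Q k -> (k <= n)%N).
  left; have [|k /asboolP Qk|d /asboolP Qd dmax] := @ex_maxnP (fun k => `[< Q k >]) n.
  - by exists k0; apply/asboolP.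
  - exact: nub.
  exists d; split=> // [k Qk|]; first by apply/dmax/asboolP.
  apply: E; split=> [_ [k Qk <-]|y]; last by apply; exists d.
  by rewrite lee_fin lez_nat; apply/dmax/asboolP.
right; split=> [n|].
  apply: contrapT => /forall2NP nQ; apply: nobound; exists n => k Qk.
  by have [//|/negP] := nQ k; rewrite -ltnNge => /ltnW.
apply: E; split=> [_ [k _ <-]|y yub]; first exact: leey.
case: y yub => [z|//|] yub; exfalso.
  apply: nobound; exists `|z|%N => k Qk.
  by have := yub k%:Z%:E; rewrite lee_fin => H; have := H (ex_intro2 _ _ k Qk erefl); lia.
by have := yub _ (ex_intro2 _ _ k0 Qk0 erefl).
Qed.

Lemma le_nat_sup (Q : set nat) t : Q 0%N ->
  (forall k l, (k <= l)%N -> Q l -> Q k) -> (t%:Z%:E <= nat_sup Q) <-> Q t.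
Proof.
move=> Q0 Qdown; have [|[d [Qd dmax ->]]|[Qinf ->]] := @nat_supP Q.
- by exists 0%N.
- rewrite lee_fin lez_nat; split=> [td|]; [exact: Qdown Qd | exact: dmax].
- by split=> _; [have [k Qk tk] := Qinf t; apply: Qdown Qk | apply: leey].
Qed.

Lemma nat_sup_infinite (Q : set nat) : Q 0%N ->
  (forall k l, (k <= l)%N -> Q l -> Q k) -> nat_sup Q = +oo <-> forall t, Q t.
Proof.
move=> Q0 Qdown; split=> [Qoo t|Qall].
  by apply/(le_nat_sup _ Q0 Qdown); rewrite Qoo leey.
have [|[d [_ dmax _]]|[_ //]] := @nat_supP Q; first by exists 0%N.
by have := dmax d.+1 (Qall _); rewrite ltnn.
Qed.

End NatSupremum.

Section Surjections.
Variable A : pzRingType.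
Implicit Types M N : lmodType A.

Definition has_sur M N : set nat :=
  [set t | exists f : {linear M -> {ffun 'I_t -> N}}, surjection f].

Lemma has_sur0 M N : has_sur M N 0%N.
Proof.
have [|f fE] := @linear_of_fun A M {ffun 'I_0 -> N} (fun=> 0).
  by move=> *; rewrite scaler0 addr0.
by exists f => y; exists 0; rewrite fE; apply/ffunP => -[].
Qed.

Lemma has_sur_le M N k l : (k <= l)%N -> has_sur M N l -> has_sur M N k.
Proof.
move=> kl [f fsurj].
have [|h hE] := @linear_of_fun A M {ffun 'I_k -> N}
    (fun x => [ffun i => f x (widen_ord kl i)]).
  by move=> a x y; apply/ffunP => i; rewrite linearP !ffunE.
exists h => y.
(* The coordinates beyond the first k are filled with 0. *)
have [x xE] := fsurj [ffun j : 'I_l => oapp y 0 (insub (val j) : option 'I_k)].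
exists x; rewrite hE; apply/ffunP => i; rewrite ffunE xE ffunE /=.
by rewrite (valK i).
Qed.

Lemma le_sur M N (t : nat) : (t%:Z%:E <= sur M N)%E <-> has_sur M N t.
Proof. by apply: le_nat_sup; [apply: has_sur0 | apply: has_sur_le]. Qed.

Lemma sur_infinite M N : sur M N = +oo%E <-> forall t, has_sur M N t.
Proof. by apply: nat_sup_infinite; [apply: has_sur0 | apply: has_sur_le]. Qed.

Lemma sur_cases M N :
  (exists d : nat, sur M N = d%:Z%:E%E) \/ sur M N = +oo%E.
Proof.
have [|[d [_ _ E]]|[_ E]] := @nat_supP (has_sur M N).
- by exists 0%N; apply: has_sur0.
- by left; exists d.
- by right.
Qed.

End Surjections.

(** The closure of a point is a chain of length 0, so for nonempty T the finite supremum is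
    attained. *)
Lemma krull_dim_cases (T : topologicalType) : (krull_dim T < +oo)%E ->
  (forall x : T, False) \/
  exists d : nat, krull_dim T = d%:Z%:E%E /\
    forall k (F : nat -> set T), irreducible_chain k F -> (k <= d)%N.
Proof.
move=> dimT; have [[x]|nT] := pselect (exists x : T, True); last first.
  by left=> x; apply: nT; exists x.
right.
have [|[d [_ dmax E]]|[_ E]] := @nat_supP [set n | exists F : nat -> set T, irreducible_chain n F].
- exists 0%N; exists (fun=> closure [set x]); split=> [i _|//].
  by split; [apply: closed_closure | apply: closure1_irreducible].
- by exists d; split=> // k F FC; apply: dmax; exists F.
by have := dimT; rewrite -[krull_dim T]/(nat_sup _) E ltxx.
Qed.

(** * From the points of Y to a global surjection *)

Section GlobalSurjection.
Variables (R : comPzRingType) (S : pzRingType) (phi : algebra_map R S).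
Variables M N : lmodType S^c.
Hypothesis finS : module_finite phi.
Hypothesis finN : finitely_generated N.
Local Notation M_R := (res_mod phi M).
Local Notation N_R := (res_mod phi N).
Local Notation Y := (@Max R `&` Supp phi N).

Lemma open_avoid (u : R) : open [set x : set_type Y | ~ spec_set (val x) u].
Proof.
have oU : open [set q : Spec R | ~ spec_set q u].
  exists [set u]; congr (~` _); apply/seteqP; split=> q /=.
    by move=> qu _ ->.
  by apply.
have /continuousP cval := @initial_continuous (set_type Y) (Spec R) set_val.
exact: cval oU.
Qed.

(** By [onto_of_onto_mod] it is enough to work modulo each maximal ideal m; outside Y one has N = m
    N. *)
Lemma has_sur_glue t s (F : 'I_s -> M_R -> N_R) (A : 'M[R]_(t, s)) :
  (forall i, restricted_hom (F i)) ->
  (forall m : Spec R, Y m -> onto_mod m (mact A @` fam_image F)) ->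
  has_sur M N t.
Proof.
move=> HF AF; have [J [g gN]] := generates_res finS finN.
have /choice[h hE] := HF.
pose f (x : M) : {ffun 'I_t -> N} := mact A [ffun i => F i x].
have [|k kE] := @linear_of_fun _ _ _ f.
  move=> a x y; apply/ffunP => i; rewrite !ffunE scaler_sumr -big_split /=.
  apply: eq_bigr => j _; rewrite !ffunE !hE linearP.
  by rewrite -[LHS]/((phi _ : S^c) *: _) scalerDr phi_scalerC.
exists k.
have sF : submod (fam_image F).
  apply: (@submod_fam_image _ N_R M_R (@restricted_hom _ _ phi M N)) => //.
  - by move=> _ x y [l ->]; apply: linearD.
  - by move=> _ c x [l ->]; apply: (linearZ_LR l (phi c : S^c) x).
have sAF := submod_mact A sF.
have onto : forall v, (mact A @` fam_image F) v.
  apply: (onto_of_onto_mod (generates_ffun gN) sAF) => I mI.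
  pose m := MkSpec (max_prime mI).
  have [Nm|Nm] := pselect (Supp phi N m); first exact: (AF m).
  exact: (@onto_mod_off_support _ _ phi m).
by move=> v; have [_ [x _ <-] <-] := onto v; exists x; rewrite kE.
Qed.

Lemma has_sur_global (I : Type) (P : I -> lmodType S^c) t d n :
  (forall i, finitely_presented (P i)) -> direct_summand M (dsum P) ->
  noetherian_space (set_type Y) ->
  (forall k (F : nat -> set (set_type Y)), irreducible_chain k F -> (k <= d)%N) ->
  (t + d <= n)%N ->
  (forall m, Y m -> has_sur (loc_mod phi m M) (loc_mod phi m N) n) ->
  has_sur M N t.
Proof.
move=> fpP MP noethY dimY tdn locsur; have [J [g gN]] := generates_res finS finN.
pose pt (x : set_type Y) : set R := spec_set (val x).
have max_pt x : is_maximal (pt x) by have [] := set_valP x.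
have [||||s [F [A [HF AF]]]] := @patched_surjection R N_R J g gN (set_type Y) pt
    noethY max_pt open_avoid M_R (@restricted_hom _ _ phi M N) _ _ _ t d n tdn dimY.
- have [|h hE] := @linear_of_fun _ M N (fun=> 0).
    by move=> *; rewrite scaler0 addr0.
  by exists h; apply/funext => x; rewrite hE.
- by move=> _ x y [l ->]; apply: linearD.
- by move=> _ c x [l ->]; apply: (linearZ_LR l (phi c : S^c) x).
- move=> x; have [G Gsurj] := locsur _ (set_valP x).
  (* [{classic I}] gives the arbitrary index type the choice structure used for finite supports. *)
  exact: (@local_family _ _ phi (val x) M N {classic I} P J g n G (max_pt x) gN fpP MP Gsurj).
apply: (has_sur_glue HF) => m Ym.
exact: (AF (exist _ m (mem_set Ym))).
Qed.

End GlobalSurjection.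

Local Open Scope ereal_scope.

Theorem theorem0p3 (R : comPzRingType) (S : pzRingType) (phi : algebra_map R S)
    (M N : lmodType S^c) :
  module_finite phi ->
  (exists (I : Type) (P : I -> lmodType S^c),
     (forall i, finitely_presented (P i)) /\ direct_summand M (dsum P)) ->
  finitely_generated N ->
  let Y : set (Spec R) := @Max R `&` Supp phi N in
  noetherian_space (set_type Y) ->
  krull_dim (set_type Y) < +oo ->
  [/\ (forall t : nat, (0 < t)%N ->
         (forall m, Y m ->
            t%:Z%:E + krull_dim (set_type Y) <= sur_at phi m M N) ->
         t%:Z%:E <= sur M N),
      (sur M N = +oo <-> forall m, Y m -> sur_at phi m M N = +oo) &
      ((exists n, Y n /\ sur_at phi n M N < +oo) ->
         emin [set sur_at phi m M N | m in Y] - krull_dim (set_type Y)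
         <= sur M N)].
Proof.
move=> finS [I [P [fpP MP]]] finN Y noethY dimY.
have [Yempty|[d [dimE dmax]]] := krull_dim_cases dimY.
  (* For empty Y the local conditions are vacuous, and [has_sur_global] with [d = 0] yields every
     t. *)
  have Y0 m : ~ Y m by move=> Ym; apply: (Yempty (exist _ m (mem_set Ym))).
  have surM t : has_sur M N t.
    apply: (@has_sur_global _ _ phi _ _ finS finN I P t 0 t) => //.
    - move=> k F [/(_ 0%N (leq0n _))[_ [[x _] _]] _]; case: (Yempty x).
    - by rewrite addn0.
    - by move=> m /Y0.
  split=> [t _ _||[m [/Y0 //]]]; first exact/le_sur.
  by split=> [_ m /Y0 //|_]; apply/sur_infinite.
have main t : (forall m, Y m -> (t + d)%N%:Z%:E <= sur_at phi m M N) ->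
    t%:Z%:E <= sur M N.
  move=> loc; apply/le_sur.
  apply: (has_sur_global finS finN fpP MP noethY dmax (leqnn _)) => m /loc.
  by move/le_sur.
split=> [t _||].
- by rewrite dimE -EFinD -PoszD; apply: main.
- split=> [/sur_infinite surM m _|loc]; apply/sur_infinite => t.
    have [f fsurj] := surM t.
    by have [G Gsurj] := @localize_surjection _ _ phi m M N t f fsurj; exists G.
  by apply/le_sur/main => m Ym; rewrite loc // leey.
move=> [n [Yn nfin]]; rewrite dimE.
set E := [set _ | _ in Y].
(* The value at [n] is finite, so a least finite value exists and [emin] does not fall back on its
   default. *)
have [e eE] : E `&` lbound E !=set0.
  have [[k kE]|koo] := sur_cases (loc_mod phi n M) (loc_mod phi n N); last first.
    by move: nfin; rewrite /sur_at koo ltxx.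
  have [|l /asboolP[m Ym mE] lmin] := @ex_minnP (fun l => `[< E l%:Z%:E >]).
    by exists k; apply/asboolP; exists n.
  exists l%:Z%:E; split; first by exists m.
  move=> _ [q Yq <-].
  have [[c cE]|coo] := sur_cases (loc_mod phi q M) (loc_mod phi q N).
    by rewrite /sur_at cE lee_fin lez_nat lmin //; apply/asboolP; exists q.
  by rewrite /sur_at coo leey.
have [[m Ym mE] elb] : (E `&` lbound E) (emin E).
  by rewrite /emin; apply: (xgetI _ eE).
have [[k kE]|koo] := sur_cases (loc_mod phi m M) (loc_mod phi m N); last first.
  have := elb _ (imageP _ Yn); rewrite -mE /sur_at koo leye_eq => /eqP noo.
  by move: nfin; rewrite /sur_at noo ltxx.
rewrite -mE /sur_at kE -EFinB.
(* If [k <= d] the bound is at most 0; otherwise [main] applies with t = k - d. *)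
have [kd|/ltnW dk] := leqP k d.
  have [_ +] := le_sur M N 0 => /(_ (has_sur0 M N)); apply: le_trans.
  by rewrite lee_fin subr_le0 lez_nat.
rewrite subzn //; apply: main => q Yq; rewrite subnK //.
by rewrite -kE; have := elb _ (imageP _ Yq); rewrite -mE.
Qed.
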